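(* There are universal constants $c_{\mathrm{bias}},c_{\mathrm{nonadaptive}}$ such that the following holds. Let $t\ge3$, $n,m\ge1$, and let $\mathcal D$ be a $(c_{\mathrm{bias}}n)^{-t}$-biased distribution over $\{0,1\}^m$. Let $C:\{0,1\}^n\to\{0,1\}^m$ be a multi-output function each of whose output bits $C(x)_i$ depends on at most $t$ bits of $x$. If $m\ge c_{\mathrm{nonadaptive}}^t\cdot n^{(t-1)/2}\cdot\log n$, then $$\Pr_{\mathbf b\sim\mathcal D}[\mathbf b\in\mathrm{Range}(C)]\le\frac23.$$
   Context: A distribution $\mathcal D$ over $\{0,1\}^m$ is $\gamma$-biased if for every nonempty $I\subseteq[m]$, $\frac12(1-\gamma)\le\Pr_{\mathbf x\sim\mathcal D}[\bigoplus_{i\in I}\mathbf x_i=0]\le\frac12(1+\gamma)$. $\mathrm{Range}(C)=\{C(x):x\in\{0,1\}^n\}$. Logarithms are base 2.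
   Formalization: The formal theorem assumes n ≥ 2 instead of n ≥ 1: at n = 1, log n = 0 makes the condition on m void, and the claim fails for n = m = 1, t = 3, uniform D and C the identity (probability 1 > 2/3). *)

(* Defs.v *)
From mathcomp Require Import all_boot all_order all_algebra.
From mathcomp Require Import reals exp.

Set Implicit Arguments.
Unset Strict Implicit.
Unset Printing Implicit Defensive.

Import Order.TTheory GRing.Theory Num.Theory.
Local Open Scope ring_scope.

Definition cube (m : nat) : finType := {ffun 'I_m -> bool}.

Record distribution (R : numDomainType) (T : finType) := Distribution {
  pmf :> T -> R;
  pmf_ge0 : forall x, 0 <= pmf x;
  pmf_sum1 : \sum_x pmf x = 1
}.

Definition Pr (R : numDomainType) (T : finType) (D : distribution R T)
    (E : pred T) : R :=
  \sum_(x | E x) D x.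

Definition parity (m : nat) (I : {set 'I_m}) (x : cube m) : bool :=
  \big[addb/false]_(i in I) x i.

Definition biased (R : numFieldType) (m : nat) (gamma : R)
    (D : distribution R (cube m)) : Prop :=
  forall I : {set 'I_m}, I != set0 ->
    2^-1 * (1 - gamma) <= Pr D (fun x => parity I x == false)
                       <= 2^-1 * (1 + gamma).

Definition depends_on_at_most (n t : nat) (f : cube n -> bool) : Prop :=
  exists2 S : {set 'I_n}, (#|S| <= t)%N &
    forall x y : cube n, {in S, x =1 y} -> f x = f y.

Definition Range (n m : nat) (C : cube n -> cube m) : {set cube m} :=
  [set C x | x in [set: cube n]].

Definition log2 (R : realType) (x : R) : R := ln x / ln 2.

(* Main.v *)
Require Import Defs.
From mathcomp Require Import all_boot all_order all_algebra.
From mathcomp Require Import reals exp ring lra zify.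

Set Implicit Arguments.
Unset Strict Implicit.
Unset Printing Implicit Defensive.

Import Order.TTheory GRing.Theory Num.Theory.
Local Open Scope ring_scope.

(** If more than [n] outputs are affine over the two-element field, some parity of them is constant on the
    range and the bias bound finishes. Otherwise most outputs [f_i] are not [+-] the full parity of their [t]
    inputs, so the top Fourier coefficient of [f_i] has absolute value at most [1 - 2^(1-t)]. If [b = C(x)],
    then [sum_i (-1)^(b_i) f_i(x)] equals the number of outputs, so some frequency [Z] of weight at most
    [t - 1] satisfies [|sum_i (-1)^(b_i) w_i chi_Z(x)| >= 2^(-O(t)) m]: the signs [b] are correlated with an
    XOR instance of degree [t - 1].

    To refute this, split [chi_Z = alpha(U_i) beta(A_i) beta(B_i)] with [A_i], [B_i] of degree
    [(t - 1) / 2] (rounded down), group the outputs by [U_i] (or by [(U_i, A_i)] when that pair is very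
    frequent) and apply Cauchy-Schwarz: the sum turns into a quadratic form in the signs of the vertices of a
    graph whose edges are the pairs [i, j] of one group, signed by [(-1)^(b_i + b_j)]. Normalise by degrees
    plus a constant, so that one gets a signed substochastic random walk [P]. A large quadratic form forces
    [<y, P^p y>] to be large for [p] of order [log n]. Its square is controlled by the second moments of the
    entries of [P^p]: walks whose labels do not cancel contribute the bias, and walks whose labels cancel
    must repeat old labels half of the time, which is unlikely. Since [y] is a sign vector, weighting
    Cauchy-Schwarz by the walk probabilities makes the bias enter without a factor for the dimension, which
    is why bias [(c n)^(-t)] suffices. *)

(** * Characters of the cube *)

Section Characters.
Context {R : realFieldType}.

(* A character of the group [(Z/2)^m] is indexed by its frequency vector; addition in the ring [bool] is xor. *)
Definition char (m : nat) (X b : {ffun 'I_m -> bool}) : R :=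
  \prod_i (-1) ^+ (X i && b i).

Definition weight (m : nat) (X : {ffun 'I_m -> bool}) : nat := \sum_i X i.

Definition unitv (m : nat) (j : 'I_m) : {ffun 'I_m -> bool} :=
  [ffun i => i == j].

Lemma xorvE (m : nat) (X Y : {ffun 'I_m -> bool}) i : (X + Y) i = X i (+) Y i.
Proof. by rewrite ffunE. Qed.

Lemma xorvv (m : nat) (X : {ffun 'I_m -> bool}) : X + X = 0.
Proof. by apply/ffunP => i; rewrite xorvE addbb ffunE. Qed.

Lemma xorvK (m : nat) (X Y : {ffun 'I_m -> bool}) : X + Y + Y = X.
Proof. by rewrite -addrA xorvv addr0. Qed.

Lemma xorv_eq0 (m : nat) (X Y : {ffun 'I_m -> bool}) : (X + Y == 0) = (X == Y).
Proof.
apply/eqP/eqP => [h|->]; last exact: xorvv.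
by rewrite -[X](xorvK X Y) h add0r.
Qed.

Lemma charC (m : nat) (X b : {ffun 'I_m -> bool}) : char X b = char b X.
Proof. by apply: eq_bigr => i _; rewrite andbC. Qed.

Lemma charD (m : nat) (X Y b : {ffun 'I_m -> bool}) :
  char (X + Y) b = char X b * char Y b.
Proof.
rewrite -big_split; apply: eq_bigr => i _ /=; rewrite xorvE.
by case: (X i); case: (Y i); case: (b i); rewrite /= ?expr0 ?expr1 ?mulr1 ?mul1r ?mulrNN ?mulr1.
Qed.

Lemma char0 (m : nat) (b : {ffun 'I_m -> bool}) : char 0 b = 1.
Proof. by apply: big1 => i _; rewrite ffunE. Qed.

Lemma char_sum (m : nat) (I : finType) (P : pred I)
    (X : I -> {ffun 'I_m -> bool}) b :
  char (\sum_(i | P i) X i) b = \prod_(i | P i) char (X i) b.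
Proof.
exact: (big_morph (fun X => char X b) (fun X Y => charD X Y b) (char0 b)).
Qed.

Lemma char_unitv (m : nat) (j : 'I_m) b : char (unitv j) b = (-1) ^+ b j.
Proof.
rewrite /char (bigD1 j) //= ffunE eqxx big1 ?mulr1 // => i ij.
by rewrite ffunE (negbTE ij).
Qed.

Lemma char_sqr (m : nat) (X b : {ffun 'I_m -> bool}) : char X b * char X b = 1.
Proof. by rewrite -charD xorvv char0. Qed.

Lemma char_sign (m : nat) (X b : {ffun 'I_m -> bool}) :
  {s : bool | char X b = (-1) ^+ s}.
Proof.
exists (\sum_i (X i && b i : bool)).
rewrite /char.
apply: (big_ind2 (fun (x : R) (y : bool) => x = (-1) ^+ y)) => [|x y x' y' -> ->|//].
  by [].
by rewrite signr_addb.
Qed.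

Lemma norm_char (m : nat) (X b : {ffun 'I_m -> bool}) : `|char X b| = 1.
Proof. by have [s ->] := char_sign X b; rewrite normr_sign. Qed.

Lemma sum_char (m : nat) (b : {ffun 'I_m -> bool}) :
  \sum_X char X b = if b == 0 then 2 ^+ m else 0.
Proof.
have [->|b0] := eqVneq b 0.
  under eq_bigr => X _ do rewrite charC char0.
  by rewrite sumr_const card_ffun card_bool card_ord natrX.
have [i bi] : exists i, b i.
  apply/existsP; apply: contraR b0; rewrite negb_exists => /forallP h.
  by apply/eqP/ffunP => i; rewrite ffunE; apply/negbTE/(h i).
(* Translating by [unitv i] flips the sign of every term, because [b i] holds. *)
have : \sum_X char X b = - \sum_X char X b.
  rewrite {1}(reindex_inj (addIr (unitv i))) -sumrN.
  apply: eq_bigr => X _.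
  by rewrite charD char_unitv bi expr1 mulrN1.
by lra.
Qed.

Definition fourier (m : nat) (f : {ffun 'I_m -> bool} -> R) X : R :=
  2 ^- m * \sum_z f z * char X z.

Lemma fourier_inversion (m : nat) (f : {ffun 'I_m -> bool} -> R) z :
  f z = \sum_X fourier f X * char X z.
Proof.
transitivity (2 ^- m * \sum_y f y * \sum_X char X (y + z)).
  rewrite (bigD1 z) //= sum_char xorvv eqxx big1 ?addr0.
    by rewrite mulrCA mulVf ?mulr1 // expf_neq0 // pnatr_eq0.
  by move=> y yz; rewrite sum_char xorv_eq0 (negbTE yz) mulr0.
rewrite mulr_sumr.
under [RHS]eq_bigr => X _ do rewrite -mulrA mulr_suml mulr_sumr.
rewrite exchange_big; apply: eq_bigr => y _ /=.
rewrite mulr_sumr mulr_sumr; apply: eq_bigr => X _.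
by rewrite charC charD -!mulrA ![char _ X]charC.
Qed.

End Characters.

(** * Expectations and labelled random walks *)

Section Expectation.
Context {R : realFieldType} {m : nat}.
Variable D : distribution R (cube m).

Definition expect (F : {ffun 'I_m -> bool} -> R) : R := \sum_b D b * F b.

Lemma expect_sum (I : finType) (P : pred I) (F : I -> {ffun 'I_m -> bool} -> R) :
  expect (fun b => \sum_(i | P i) F i b) = \sum_(i | P i) expect (F i).
Proof. by rewrite exchange_big; apply: eq_bigr => b _; rewrite mulr_sumr. Qed.

Lemma expectZ c (F : {ffun 'I_m -> bool} -> R) :
  expect (fun b => c * F b) = c * expect F.
Proof. by rewrite mulr_sumr; apply: eq_bigr => b _; rewrite mulrCA. Qed.

Lemma eq_expect (F F' : {ffun 'I_m -> bool} -> R) :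
  F =1 F' -> expect F = expect F'.
Proof. by move=> h; apply: eq_bigr => b _; rewrite h. Qed.

Lemma le_expect (F F' : {ffun 'I_m -> bool} -> R) :
  (forall b, F b <= F' b) -> expect F <= expect F'.
Proof. by move=> h; apply: ler_sum => b _; rewrite ler_wpM2l ?pmf_ge0. Qed.

Lemma expect1 : expect (fun=> 1) = 1.
Proof. by rewrite -[RHS](pmf_sum1 D); apply: eq_bigr => b _; rewrite mulr1. Qed.

Lemma PrE (P : pred (cube m)) : Pr D P = expect (fun b => (P b)%:R).
Proof.
by rewrite /Pr big_mkcond; apply: eq_bigr => b _; case: (P b); rewrite ?mulr1 ?mulr0.
Qed.

(** A character is twice the indicator of even parity, minus 1, so the window of width [gamma]
    around 1/2 becomes one of radius [gamma] around 0. *)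
Lemma biased_expect gamma (X : {ffun 'I_m -> bool}) :
  biased gamma D -> X != 0 -> `|expect (char X)| <= gamma.
Proof.
move=> bD X0; set I := [set i | X i].
have I0 : I != set0.
  apply: contraNneq X0 => I0; apply/eqP/ffunP => i; rewrite ffunE.
  by have := in_set0 i; rewrite -I0 inE.
have charE b : char X b = 2 * (parity I b == false)%:R - 1 :> R.
  have -> : char X b = (-1) ^+ parity I b :> R.
    rewrite /parity big_mkcond /char /=.
    apply: (big_ind2 (fun (x : R) (y : bool) => x = (-1) ^+ y)) => [//|x y x' y' -> ->|i _].
      by rewrite signr_addb.
    by rewrite inE; case: (X i).
  by case: parity; rewrite /= ?expr0 ?expr1; ring.
have -> : expect (char X) = 2 * Pr D (fun b => parity I b == false) - 1.
  rewrite PrE -expectZ -[X in _ - X]expect1 /expect -sumrB; apply: eq_bigr => b _.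
  by rewrite charE; ring.
have /andP[h1 h2] := bD I I0.
by rewrite ler_norml; apply/andP; split; lra.
Qed.

End Expectation.

Section Walks.
Context {R : realFieldType} {m : nat} {V E : finType}.
Variables (src dst : E -> V) (lab : E -> {ffun 'I_m -> bool}) (deg : V -> R).
Implicit Types (a w : E -> R) (f g : {ffun 'I_m -> bool} -> V -> R).

(* One step of the random walk on [V], with the xor of the traversed labels recorded in the first component. *)
Definition walk_op a f X u : R :=
  \sum_(e | src e == u) a e / deg u * f (X + lab e) (dst e).

Definition walks a k f := iter k (walk_op a) f.

(** Used as final value, this gives the matrix entries of the walk: [walks a k (dirac Y v) X u] is
    the total weight of the [k]-step walks from [u] to [v] whose labels xor to [X + Y]. *)
Definition dirac (Y : {ffun 'I_m -> bool}) (v : V) X u : R :=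
  ((X == Y) && (u == v))%:R.

Lemma walksS a k f X u :
  walks a k.+1 f X u =
  \sum_(e | src e == u) a e / deg u * walks a k f (X + lab e) (dst e).
Proof. by []. Qed.

Lemma eq_walks a k f g : f =2 g -> walks a k f =2 walks a k g.
Proof.
move=> fg; elim: k => [//|k IH] X u.
by rewrite !walksS; apply: eq_bigr => e _; rewrite IH.
Qed.

Lemma walks_lin a k (I : finType) (c : I -> R) (F : I -> {ffun 'I_m -> bool} -> V -> R) X u :
  walks a k (fun Y v => \sum_i c i * F i Y v) X u = \sum_i c i * walks a k (F i) X u.
Proof.
elim: k X u => [//|k IH] X u; rewrite walksS.
under eq_bigr => e _ do rewrite IH mulr_sumr.
rewrite exchange_big; apply: eq_bigr => i _.
by rewrite walksS mulr_sumr; apply: eq_bigr => e _; rewrite mulrCA.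
Qed.

Lemma walks_shift a k f X Y u :
  walks a k f (X + Y) u = walks a k (fun Z => f (Z + Y)) X u.
Proof.
elim: k X u => [//|k IH] X u; rewrite !walksS.
by apply: eq_bigr => e _; rewrite -IH addrAC.
Qed.

Lemma sum_dirac f X u : \sum_z f z.1 z.2 * dirac z.1 z.2 X u = f X u.
Proof.
rewrite (bigD1 (X, u)) //= /dirac !eqxx mulr1 big1 ?addr0 // => -[Y v] /= h.
by rewrite [X == _]eq_sym [u == _]eq_sym -xpair_eqE (negbTE h) mulr0.
Qed.

Lemma walks_expand a k f X u :
  walks a k f X u = \sum_z f z.1 z.2 * walks a k (dirac z.1 z.2) X u.
Proof.
by rewrite -walks_lin; apply: eq_walks => Y v; rewrite sum_dirac.
Qed.

Lemma walks_comp a j k f X u :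
  walks a (j + k) f X u = walks a j (walks a k f) X u.
Proof. by rewrite /walks iterD. Qed.

Section Nonneg.
Variable a : E -> R.
Hypotheses (a_ge0 : forall e, 0 <= a e) (deg_gt0 : forall v, 0 < deg v).

Lemma step_ge0 e u : 0 <= a e / deg u.
Proof. by rewrite divr_ge0 // ltW. Qed.

Lemma walks_le k f g X u :
  (forall Y v, f Y v <= g Y v) -> walks a k f X u <= walks a k g X u.
Proof.
move=> fg; elim: k X u => [//|k IH] X u; rewrite !walksS.
by apply: ler_sum => e _; rewrite ler_wpM2l // step_ge0.
Qed.

Lemma walks_ge0 k f X u :
  (forall Y v, 0 <= f Y v) -> 0 <= walks a k f X u.
Proof.
move=> f0; elim: k X u => [//|k IH] X u; rewrite walksS.
by apply: sumr_ge0 => e _; rewrite mulr_ge0 // step_ge0.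
Qed.

Lemma walks_norm w k f X u : (forall e, `|w e| <= a e) -> (forall Y v, 0 <= f Y v) ->
  `|walks w k f X u| <= walks a k f X u.
Proof.
move=> wa f0; elim: k X u => [|k IH] X u; first by rewrite /walks /= ger0_norm.
rewrite !walksS; apply: le_trans (ler_norm_sum _ _ _) _; apply: ler_sum => e _.
rewrite normrM ler_pM // normrM normfV (gtr0_norm (deg_gt0 _)).
by rewrite ler_pM2r ?invr_gt0.
Qed.

Lemma walks_le1 k X u :
  (forall v, \sum_(e | src e == v) a e <= deg v) -> walks a k (fun _ _ => 1) X u <= 1.
Proof.
move=> hdeg; elim: k X u => [//|k IH] X u; rewrite walksS.
apply: (@le_trans _ _ (\sum_(e | src e == u) a e / deg u)).
  by apply: ler_sum => e _; rewrite ler_piMr // step_ge0.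
by rewrite -mulr_suml ler_pdivrMr // mul1r.
Qed.

End Nonneg.

Section Reversible.
Variables (rev : E -> E) (a : E -> R).
Hypotheses (revK : involutive rev) (src_rev : forall e, src (rev e) = dst e).
Hypotheses (a_rev : forall e, a (rev e) = a e) (lab_rev : forall e, lab (rev e) = lab e).
Hypothesis deg_gt0 : forall v, 0 < deg v.

Lemma dst_rev e : dst (rev e) = src e.
Proof. by rewrite -{2}[e]revK src_rev. Qed.

(** The factor [deg u] cancels the normalisation. What remains is a sum over positions and edges,
    invariant under reversing the edge while shifting [X] by its label. *)
Lemma walk_op_sym f g :
  \sum_X \sum_u deg u * f X u * walk_op a g X u =
  \sum_X \sum_u deg u * walk_op a f X u * g X u.
Proof.
have expand f' g' : \sum_X \sum_u deg u * f' X u * walk_op a g' X u =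
    \sum_X \sum_e a e * (f' X (src e) * g' (X + lab e) (dst e)).
  apply: eq_bigr => X _; rewrite (partition_big src predT) //=.
  apply: eq_bigr => u _; rewrite mulr_sumr; apply: eq_bigr => e /eqP <-.
  by field; rewrite gt_eqF.
rewrite expand.
under [RHS]eq_bigr => X _ do under eq_bigr => u _ do rewrite mulrAC.
rewrite expand [LHS]exchange_big [RHS]exchange_big [LHS](reindex_inj (inv_inj revK)).
apply: eq_bigr => e _; rewrite (reindex_inj (addIr (lab e))) /=.
apply: eq_bigr => X _.
by rewrite a_rev src_rev lab_rev dst_rev xorvK [f _ _ * _]mulrC.
Qed.

Lemma walks_sym k f g :
  \sum_X \sum_u deg u * f X u * walks a k g X u =
  \sum_X \sum_u deg u * walks a k f X u * g X u.
Proof.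
elim: k f g => [//|k IH] f g; rewrite walk_op_sym IH.
by rewrite /walks -iterSr.
Qed.

(** Detailed balance: self-adjointness is applied to two point masses, and translation by [O] brings
    the start back to 0. *)
Lemma walks_reversible k O u v :
  deg u * walks a k (dirac O v) 0 u = deg v * walks a k (dirac O u) 0 v.
Proof.
have pick h Y x : \sum_X \sum_z deg z * dirac Y x X z * h X z = deg x * h Y x.
  rewrite pair_big -(sum_dirac (fun X z => deg z * h X z)).
  by apply: eq_bigr => -[X z] _ /=; rewrite /dirac [X == _]eq_sym [z == _]eq_sym; ring.
rewrite -(pick (walks a k (dirac O v)) 0 u) walks_sym.
under eq_bigr => X _ do under eq_bigr => z _ do rewrite mulrAC.
rewrite pick -[in LHS](add0r O) walks_shift; congr (_ * _).
apply: eq_walks => X z; rewrite /dirac.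
by rewrite xorv_eq0.
Qed.

End Reversible.
End Walks.

(** * The trace method *)

(** Lagrange's identity: the difference of the two sides is half of a weighted double sum of
    squares. *)
Lemma cauchy_schwarz (R : realFieldType) (I : finType) (p f g : I -> R) :
  (forall i, 0 <= p i) ->
  (\sum_i p i * f i * g i) ^+ 2 <=
  (\sum_i p i * f i ^+ 2) * (\sum_i p i * g i ^+ 2).
Proof.
move=> p0; rewrite -subr_ge0.
have : 0 <= \sum_i \sum_j p i * p j * (f i * g j - f j * g i) ^+ 2.
  by do 2!(apply: sumr_ge0 => ? _); rewrite mulr_ge0 ?sqr_ge0 // mulr_ge0.
have -> : \sum_i \sum_j p i * p j * (f i * g j - f j * g i) ^+ 2 =
    2 * ((\sum_i p i * f i ^+ 2) * (\sum_i p i * g i ^+ 2) -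
         (\sum_i p i * f i * g i) ^+ 2).
  transitivity (\sum_i \sum_j (p i * f i ^+ 2) * (p j * g j ^+ 2) +
      \sum_i \sum_j (p i * g i ^+ 2) * (p j * f j ^+ 2) -
      2 * \sum_i \sum_j (p i * f i * g i) * (p j * f j * g j)).
    rewrite mulr_sumr -big_split -sumrB; apply: eq_bigr => i _ /=.
    rewrite mulr_sumr -big_split -sumrB; apply: eq_bigr => j _ /=.
    by ring.
  by rewrite -!big_distrlr /=; ring.
by rewrite pmulr_rge0 // ltr0n.
Qed.

Section Weight.
Context {m : nat}.
Implicit Types (X : {ffun 'I_m -> bool}) (j : 'I_m).

(** Both corrections are added, one on each side, to avoid truncated subtraction. *)
Lemma weight_unitv X j : (weight (X + unitv j)%R + X j = weight X + ~~ X j)%N.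
Proof.
rewrite /weight (bigD1 j) //= [in RHS](bigD1 j) //= xorvE ffunE eqxx addbT.
rewrite (eq_bigr (fun i => nat_of_bool (X i))); last by move=> i ij; rewrite xorvE ffunE (negbTE ij) addbF.
by case: (X j); rewrite /=; lia.
Qed.

Lemma weight_add2 X j j' : (weight X <= weight (X + (unitv j + unitv j'))%R + 2)%N.
Proof.
rewrite addrA; have := weight_unitv X j; have := weight_unitv (X + unitv j) j'.
move: (weight (X + unitv j + unitv j')) (weight (X + unitv j)) (weight X) => a b e.
by case: (X j); case: ((X + unitv j) j') => /=; lia.
Qed.

Lemma weight_le_add2 X j j' : (weight (X + (unitv j + unitv j'))%R <= weight X + 2)%N.
Proof.
rewrite addrA; have := weight_unitv X j; have := weight_unitv (X + unitv j) j'.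
move: (weight (X + unitv j + unitv j')) (weight (X + unitv j)) (weight X) => a b e.
by case: (X j); case: ((X + unitv j) j') => /=; lia.
Qed.

Lemma weight_fresh X j j' : j != j' -> ~~ X j -> ~~ X j' ->
  weight (X + (unitv j + unitv j')) = (weight X + 2)%N.
Proof.
move=> jj' /negbTE Xj /negbTE Xj'.
rewrite addrA; have := weight_unitv X j; have := weight_unitv (X + unitv j) j'.
have -> : (X + unitv j) j' = false by rewrite xorvE ffunE Xj' eq_sym (negbTE jj').
rewrite Xj /=.
move: (weight (X + unitv j + unitv j')) (weight (X + unitv j)) (weight X) => a b e.
by lia.
Qed.

Lemma weight0 : weight (0 : {ffun 'I_m -> bool}) = 0%N.
Proof. by apply: big1 => i _; rewrite ffunE. Qed.

End Weight.

(** * The test for a large quadratic form on a signed graph *)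

Section TraceTest.
Context {R : realFieldType} {m : nat} {V E : finType}.
Variables (src dst : E -> V) (rev : E -> E) (l1 l2 : E -> 'I_m) (c w : E -> R).
Variables (d theta kappa : R) (p : nat).
Hypotheses (revK : involutive rev) (src_rev : forall e, src (rev e) = dst e).
Hypotheses (l1_rev : forall e, l1 (rev e) = l1 e) (l2_rev : forall e, l2 (rev e) = l2 e).
Hypotheses (c_rev : forall e, c (rev e) = c e) (w_rev : forall e, w (rev e) = w e).
Hypotheses (wc : forall e, `|w e| <= c e) (l12 : forall e, c e != 0 -> l1 e != l2 e).
Hypotheses (d_gt0 : 0 < d) (theta_gt0 : 0 < theta) (theta_le1 : theta <= 1).

Let lab e := unitv (l1 e) + unitv (l2 e).
Let touched (X : {ffun 'I_m -> bool}) e := X (l1 e) || X (l2 e).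
(** The constant [d] keeps degrees positive and makes the mass of touched edges small relative to
    [deg v] even at vertices with few edges. *)
Let deg v := \sum_(e | src e == v) c e + d.
Let T := \sum_e c e + #|V|%:R * d.

Hypothesis touched_mass : forall X u,
  \sum_(e | (src e == u) && touched X e) c e <= (weight X)%:R * kappa.
Hypotheses (kappa_ge0 : 0 <= kappa) (kappa_small : (4 * p)%:R * kappa <= theta ^+ 4 * d).

Let c_ge0 e : 0 <= c e. Proof. exact: le_trans (wc e). Qed.

Let le_deg v : \sum_(e | src e == v) c e <= deg v.
Proof. by rewrite lerDl ltW. Qed.

Let deg_gt0 v : 0 < deg v.
Proof. by rewrite ltr_wpDl // sumr_ge0. Qed.

Let lab_rev e : lab (rev e) = lab e.
Proof. by rewrite /lab l1_rev l2_rev. Qed.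

Let sum_deg : \sum_v deg v = T.
Proof.
rewrite big_split /= sumr_const -[d *+ _]mulr_natl; congr (_ + _).
by rewrite [RHS](partition_big src predT).
Qed.

(* A step whose labels both avoid the current xor raises its weight by two; the other steps carry at most a
   [theta ^+ 4] fraction of the mass and lower the weight by at most two. Both cases gain [theta ^+ 2]. *)
Lemma walks_decay k X u : (weight X + 2 * k <= 4 * p)%N ->
  walks src dst lab deg c k (fun Y _ => theta ^+ weight Y) X u <=
  (2 * theta ^+ 2) ^+ k * theta ^+ weight X.
Proof.
elim: k X u => [|k IH] X u hk; first by rewrite /walks /= expr0 mul1r.
have t2 : 0 < theta ^+ 2 by rewrite exprn_gt0.
have B0 : 0 < theta ^+ weight X by rewrite exprn_gt0.
have s0 e v : 0 <= c e / deg v by rewrite divr_ge0 // ltW.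
have G0 : 0 <= (2 * theta ^+ 2) ^+ k by rewrite exprn_ge0 // mulr_ge0 // ltW.
rewrite walksS.
apply: (@le_trans _ _ (\sum_(e | src e == u) (2 * theta ^+ 2) ^+ k * theta ^+ weight X *
   (theta ^+ 2 * (c e / deg u) + (touched X e)%:R * theta ^- 2 * (c e / deg u)))).
  apply: ler_sum => e _.
  have [ce0|ce0] := eqVneq (c e) 0; first by rewrite ce0 !(mul0r, mulr0, addr0).
  apply: (@le_trans _ _ (c e / deg u *
      ((2 * theta ^+ 2) ^+ k * theta ^+ weight (X + lab e)))).
    rewrite ler_wpM2l // IH //.
    by have := weight_le_add2 X (l1 e) (l2 e); rewrite -/(lab e); lia.
  rewrite mulrCA -mulrA ler_wpM2l // -mulrDl mulrA [leRHS]mulrC ler_wpM2l //.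
  have [te|te] := boolP (touched X e).
    apply: (@le_trans _ _ (theta ^+ weight X * theta ^- 2)).
      rewrite ler_pdivlMr // -exprD; apply: ler_wiXn2l; rewrite ?(ltW theta_gt0) //.
      exact: weight_add2.
    by rewrite ler_pM2l // mul1r lerDr ltW.
  rewrite mul0r addr0 -exprD.
  move: te; rewrite negb_or => /andP[h1 h2].
  by rewrite /lab (weight_fresh (l12 ce0) h1 h2).
rewrite -mulr_sumr [X in _ <= X * _]exprSr [leRHS]mulrAC ler_wpM2l //; first by rewrite mulr_ge0 // ltW.
rewrite big_split /= -!mulr_sumr (_ : 2 * theta ^+ 2 = theta ^+ 2 + theta ^+ 2); last by ring.
rewrite lerD //.
  by rewrite ler_piMr ?(ltW t2) // -mulr_suml ler_pdivrMr // mul1r le_deg.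
have -> : \sum_(e | src e == u) (touched X e)%:R * theta ^- 2 * (c e / deg u) =
    theta ^- 2 / deg u * \sum_(e | (src e == u) && touched X e) c e.
  rewrite big_mkcondr mulr_sumr; apply: eq_bigr => e _.
  by case: (touched X e); rewrite /= ?mul1r ?mul0r ?mulr0 //; ring.
rewrite mulrAC ler_pdivrMr // mulrC ler_pdivrMr //.
apply: (le_trans (touched_mass X u)).
apply: (@le_trans _ _ ((4 * p)%:R * kappa)).
  by rewrite ler_wpM2r // ler_nat; lia.
apply: (le_trans kappa_small).
rewrite [leRHS](_ : _ = theta ^+ 4 * deg u); last by ring.
rewrite ler_wpM2l ?exprn_ge0 ?(ltW theta_gt0) //.
by rewrite lerDr sumr_ge0.
Qed.

Let P b y u : R := \sum_(e | src e == u) w e / deg u * char (lab e) b * y (dst e).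

(** Once [b] is fixed, the recorded xor only contributes a sign, so the labelled walk collapses to
    the operator [P b] on functions of the vertex. *)
Let walks_char b y k X u :
  walks src dst lab deg w k (fun Y v => char Y b * y v) X u = char X b * iter k (P b) y u.
Proof.
elim: k X u => [//|k IH] X u; rewrite walksS iterS mulr_sumr.
by apply: eq_bigr => e _; rewrite IH charD; ring.
Qed.

Let P_sym b f g : \sum_u deg u * f u * P b g u = \sum_u deg u * P b f u * g u.
Proof.
have expand f' g' : \sum_u deg u * f' u * P b g' u =
    \sum_e w e * char (lab e) b * (f' (src e) * g' (dst e)).
  rewrite (partition_big src predT) //=; apply: eq_bigr => u _.
  rewrite mulr_sumr; apply: eq_bigr => e /eqP <-.
  by field; rewrite gt_eqF.
under [RHS]eq_bigr => u _ do rewrite mulrAC.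
rewrite !expand (reindex_inj (inv_inj revK)); apply: eq_bigr => e _.
by rewrite w_rev lab_rev src_rev -(src_rev (rev e)) revK mulrC [g _ * _]mulrC mulrC.
Qed.

Let iterP_sym b f g k :
  \sum_u deg u * f u * iter k (P b) g u = \sum_u deg u * iter k (P b) f u * g u.
Proof.
elim: k f g => [//|k IH] f g; first by rewrite iterS P_sym IH -iterSr.
Qed.

(** Repeated squaring: since [P b] is self-adjoint for [deg], the form at exponent [2 ^ k.+1] is the
    squared norm of the iterate at [2 ^ k]. Cauchy-Schwarz against [y], whose squared norm is [T],
    bounds it below. *)
Let iterP_growth b y eta k : 0 <= eta -> (forall v, y v ^+ 2 = 1) ->
  eta * T <= \sum_u deg u * y u * P b y u ->
  eta ^+ (2 ^ k) * T <= \sum_u deg u * y u * iter (2 ^ k) (P b) y u.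
Proof.
move=> eta0 y1 h; elim: k => [//|k IH].
have T0 : 0 <= T by rewrite -sum_deg sumr_ge0 // => v _; rewrite ltW.
have [T1|T1] := eqVneq T 0.
  have deg0 v : deg v = 0.
    move: T1; rewrite -sum_deg => /eqP; rewrite psumr_eq0 => [/allP|i _]; last exact: ltW.
    by move/(_ v (mem_index_enum v))/eqP.
  by rewrite T1 mulr0 big1 // => v _; rewrite deg0 !mul0r.
have Tpos : 0 < T by rewrite lt_def T1.
rewrite expnS mul2n -addnn iterD iterP_sym exprD.
have := @cauchy_schwarz R V deg y (iter (2 ^ k) (P b) y) (fun v => ltW (deg_gt0 v)).
have -> : \sum_i deg i * y i ^+ 2 = T.
  by rewrite -sum_deg; apply: eq_bigr => v _; rewrite y1 mulr1.
under [X in _ -> _ <= X]eq_bigr => v _ do rewrite -mulrA -expr2.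
move=> cs; rewrite -(ler_pM2l Tpos); apply: le_trans cs.
apply: (@le_trans _ _ ((eta ^+ (2 ^ k) * T) ^+ 2)); first by rewrite le_eqVlt; apply/orP; left; apply/eqP; ring.
by rewrite ler_sqr // nnegrE ?mulr_ge0 ?exprn_ge0 //; apply: le_trans IH; rewrite ?mulr_ge0 ?exprn_ge0.
Qed.

(** [A] refines the [p]-step transition weight [Q] by the xor [O] of the labels. [K b] is the kernel
    of the [p]-th power of [P b], its walks grouped by the same xor. *)
Let A O u v : R := walks src dst lab deg c p (dirac O v) 0 u.
Let K b u v : R := \sum_O walks src dst lab deg w p (dirac O v) 0 u * char O b.
Let Q u v : R := \sum_O A O u v.
(* Cauchy-Schwarz weights: [Q] makes the bias term dimension-free, [deg v / T] serves the cancelling walks. *)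
Let q u v : R := Q u v + deg v / T.

Let dirac_ge0 O v X u : 0 <= @dirac R m V O v X u.
Proof. exact: ler0n. Qed.

Let A_ge0 O u v : 0 <= A O u v.
Proof. by apply: walks_ge0. Qed.

Let iterP_kernel b y u : iter p (P b) y u = \sum_v K b u v * y v.
Proof.
have := walks_char b y p 0 u; rewrite char0 mul1r => <-.
rewrite walks_expand -(pair_big xpredT xpredT (fun O v =>
  char O b * y v * walks src dst lab deg w p (dirac O v) 0 u)) exchange_big /=.
by apply: eq_bigr => v _; rewrite mulr_suml; apply: eq_bigr => O _; ring.
Qed.

Let sum_Q u : \sum_v Q u v <= 1.
Proof.
apply: (@le_trans _ _ (walks src dst lab deg c p (fun _ _ => 1) 0 u));
  last exact: walks_le1.
rewrite [leRHS]walks_expand -(pair_big xpredT xpredT (fun O v => 1 * A O u v)) exchange_big /=.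
by under [leRHS]eq_bigr => v _ do under eq_bigr => O _ do rewrite mul1r.
Qed.

(** Gluing two walks of length [p] gives a closed walk of length [2 * p] whose labels cancel. The
    indicator of a zero xor is at most [theta ^+ weight], so [walks_decay] applies. *)
Let sum_A2 u : \sum_v \sum_O A O u v * A O v u <= (2 * theta ^+ 2) ^+ (2 * p).
Proof.
have -> : \sum_v \sum_O A O u v * A O v u =
    walks src dst lab deg c (p + p) (dirac 0 u) 0 u.
  rewrite walks_comp walks_expand.
  rewrite -(pair_big xpredT xpredT (fun O v => walks src dst lab deg c p (dirac 0 u) O v *
     walks src dst lab deg c p (dirac O v) 0 u)) exchange_big /=.
  apply: eq_bigr => v _; apply: eq_bigr => O _; rewrite mulrC; congr (_ * _).
  rewrite -[O in RHS]add0r walks_shift; apply: eq_walks => X z.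
  by rewrite /dirac xorv_eq0.
rewrite addnn -mul2n.
apply: (@le_trans _ _ (walks src dst lab deg c (2 * p) (fun Y _ => theta ^+ weight Y) 0 u)).
  apply: walks_le => // Y v; rewrite /dirac; case: eqP => [->|_] /=; last by rewrite exprn_ge0 // ltW.
  by rewrite weight0 expr0 lern1; case: eqP.
apply: le_trans (walks_decay _ _) _; first by rewrite weight0; lia.
by rewrite weight0 mulr1.
Qed.

Section Bias.
Variables (D : distribution R (cube m)) (gamma : R).
Hypotheses (bias : biased gamma D) (gamma_ge0 : 0 <= gamma).

(** Squaring gives pairs of xors: on equal pairs the character is 1, on distinct ones its mean is at
    most [gamma] in absolute value. *)
Let expect_K2 u v :
  expect D (fun b => K b u v ^+ 2) <= \sum_O A O u v ^+ 2 + gamma * Q u v ^+ 2.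
Proof.
have -> : expect D (fun b => K b u v ^+ 2) = \sum_O \sum_O'
    walks src dst lab deg w p (dirac O v) 0 u * walks src dst lab deg w p (dirac O' v) 0 u *
    expect D (char (O + O')).
  under eq_expect => b do rewrite expr2 /K big_distrlr /=.
  rewrite expect_sum; apply: eq_bigr => O _; rewrite expect_sum; apply: eq_bigr => O' _.
  by rewrite -expectZ; apply: eq_expect => b; rewrite charD; ring.
have -> : \sum_O A O u v ^+ 2 + gamma * Q u v ^+ 2 =
    \sum_O \sum_O' A O u v * A O' u v * ((O == O')%:R + gamma).
  rewrite expr2 /Q big_distrlr /= mulr_sumr -big_split; apply: eq_bigr => O _ /=.
  under [RHS]eq_bigr => O' _ do rewrite mulrDr.
  rewrite big_split mulr_sumr /=; congr (_ + _).
    rewrite (bigD1 O) //= eqxx mulr1 -expr2 big1 ?addr0 // => O' h.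
    by rewrite eq_sym (negbTE h) mulr0.
  by apply: eq_bigr => O' _; rewrite mulrC.
apply: ler_sum => O _; apply: ler_sum => O' _.
apply: le_trans (ler_norm _) _; rewrite !normrM.
have nA O1 : `|walks src dst lab deg w p (dirac O1 v) 0 u| <= A O1 u v.
  by apply: walks_norm.
rewrite ler_pM ?mulr_ge0 // ?ler_pM //.
have [<-|OO'] := eqVneq O O'.
  rewrite xorvv (@eq_expect _ _ D _ (fun=> 1)) => [|b]; last exact: char0.
  by rewrite expect1 normr1 lerDl.
by rewrite add0r; apply: biased_expect => //; rewrite xorv_eq0.
Qed.

Lemma trace_test eta j : (0 < #|V|)%N -> 0 < eta -> p = (2 ^ j)%N ->
  exists Phi : {ffun 'I_m -> bool} -> R, [/\ forall b, 0 <= Phi b,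
    expect D Phi <= 2 * eta ^- (2 * p) * (gamma + #|V|%:R * (2 * theta ^+ 2) ^+ (2 * p)) &
    forall b (y : V -> R), (forall v, y v ^+ 2 = 1) ->
      eta * T <= \sum_e w e * char (lab e) b * (y (src e) * y (dst e)) -> 1 <= Phi b].
Proof.
move=> V0 eta0 pE.
have T0 : 0 < T.
  have /card_gt0P[v _] := V0.
  rewrite -sum_deg (bigD1 v) //= ltr_pwDl // sumr_ge0 // => z _; exact: ltW.
have e0 k : 0 < eta ^+ k by rewrite exprn_gt0.
have Q0 u v : 0 <= Q u v by apply: sumr_ge0.
have q0 u v : 0 < q u v by rewrite ltr_wpDl // divr_gt0.
(* Up to scaling, a weighted Frobenius norm of the [p]-th power of [P b]. It controls every sign
   vector [y] at once and depends on [b] only. *)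
exists (fun b => 2 * eta ^- (2 * p) / T * \sum_u deg u * \sum_v K b u v ^+ 2 / q u v).
split=> [b||b y y1 h].
- rewrite mulr_ge0 ?divr_ge0 ?mulr_ge0 ?invr_ge0 ?(ltW (e0 _)) ?(ltW T0) //.
  apply: sumr_ge0 => u _; rewrite mulr_ge0 ?(ltW (deg_gt0 _)) //.
  by apply: sumr_ge0 => v _; rewrite divr_ge0 ?sqr_ge0 // ltW.
- rewrite expectZ -[leLHS]mulrA ler_wpM2l ?mulr_ge0 ?invr_ge0 ?(ltW (e0 _)) // ler_pdivrMl //.
  rewrite expect_sum.
  apply: (@le_trans _ _ (\sum_u (deg u * gamma +
      T * \sum_v \sum_O A O u v * A O v u))).
    apply: ler_sum => u _; rewrite expectZ.
    apply: (@le_trans _ _ (deg u * \sum_v (gamma * Q u v +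
        T / deg v * \sum_O A O u v ^+ 2))).
      rewrite ler_wpM2l ?(ltW (deg_gt0 _)) // expect_sum; apply: ler_sum => v _.
      under eq_expect => b do rewrite mulrC.
      rewrite expectZ mulrC ler_pdivrMr //.
      apply: (le_trans (expect_K2 u v)).
      have A2 : 0 <= \sum_O A O u v ^+ 2 by apply: sumr_ge0 => O _; rewrite sqr_ge0.
      have Td : 0 < T / deg v by rewrite divr_gt0.
      (* The second-moment bound is the first two terms of this expansion; the cross terms are
         nonnegative. The two summands of [q] thus serve the bias and the cancelling walks
         separately. *)
      have -> : (gamma * Q u v + T / deg v * \sum_O A O u v ^+ 2) * q u v =
        \sum_O A O u v ^+ 2 + gamma * Q u v ^+ 2 + gamma * Q u v * (deg v / T) +
          T / deg v * (\sum_O A O u v ^+ 2) * Q u v.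
        by rewrite /q; field; rewrite !gt_eqF.
      have dT : 0 < deg v / T by rewrite divr_gt0.
      rewrite -addrA lerDl addr_ge0 // mulr_ge0 //.
      - by rewrite mulr_ge0.
      - exact: ltW.
      - by rewrite mulr_ge0 // ltW.
    rewrite mulr_sumr.
    have -> : \sum_v deg u * (gamma * Q u v + T / deg v * \sum_O A O u v ^+ 2) =
        deg u * gamma * \sum_v Q u v + T * \sum_v \sum_O A O u v * A O v u.
      rewrite !mulr_sumr -big_split; apply: eq_bigr => v _ /=.
      (* Reversibility turns [deg u / deg v] times the square of [A O u v] into [A O u v * A O v u],
         a weight of closed walks. *)
      rewrite mulrDr mulrA; congr (_ + _).
      rewrite !mulr_sumr; apply: eq_bigr => O _.
      have := @walks_reversible R m V E src dst lab deg rev c revK src_rev c_rev lab_rev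
        deg_gt0 p O u v.
      rewrite -/(A O u v) -/(A O v u) => h.
      have -> : A O v u = deg u * A O u v / deg v by rewrite h mulrAC mulfV ?mul1r ?gt_eqF.
      by field; rewrite gt_eqF.
    by rewrite lerD2r ler_piMr // mulr_ge0 // ltW.
  rewrite big_split /= -mulr_suml sum_deg mulrDr lerD2l -mulr_sumr ler_wpM2l ?(ltW T0) //.
  rewrite mulr_natl -sumr_const; apply: ler_sum => u _; exact: sum_A2.
have hP : eta * T <= \sum_u deg u * y u * P b y u.
  apply: le_trans h _; rewrite le_eqVlt; apply/orP; left; apply/eqP.
  rewrite (partition_big src predT) //=; apply: eq_bigr => u _.
  rewrite mulr_sumr; apply: eq_bigr => e /eqP <-.
  by field; rewrite gt_eqF.
have hp := iterP_growth j (ltW eta0) y1 hP; rewrite -pE in hp.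
rewrite mulrAC ler_pdivlMr // mul1r mulrAC ler_pdivlMr // mulrC.
have cs := @cauchy_schwarz R V deg y (iter p (P b) y) (fun v => ltW (deg_gt0 v)).
have yT : \sum_i deg i * y i ^+ 2 = T.
  by rewrite -sum_deg; apply: eq_bigr => v _; rewrite y1 mulr1.
rewrite yT in cs.
rewrite -(ler_pM2l T0).
apply: (@le_trans _ _ ((eta ^+ p * T) ^+ 2)).
  by rewrite le_eqVlt; apply/orP; left; apply/eqP; rewrite mulnC exprM; ring.
apply: (@le_trans _ _ ((\sum_u deg u * y u * iter p (P b) y u) ^+ 2)).
  have eT : 0 <= eta ^+ p * T by rewrite mulr_ge0 // ltW.
  by rewrite ler_sqr ?nnegrE //; exact: le_trans hp.
apply: le_trans cs _; rewrite ler_wpM2l ?(ltW T0) // mulr_sumr.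
apply: ler_sum => u _.
rewrite [leRHS]mulrCA ler_wpM2l ?(ltW (deg_gt0 _)) //.
rewrite iterP_kernel.
have := @cauchy_schwarz R V (q u) (fun v => K b u v / q u v) y (fun v => ltW (q0 u v)).
have -> : \sum_v q u v * (K b u v / q u v) * y v = \sum_v K b u v * y v.
  by apply: eq_bigr => v _; rewrite mulrCA mulfV ?mulr1 // gt_eqF.
move=> cs2; apply: le_trans cs2 _; rewrite mulrC.
have -> : \sum_v q u v * (K b u v / q u v) ^+ 2 = \sum_v K b u v ^+ 2 / q u v.
  by apply: eq_bigr => v _; field; rewrite gt_eqF.
rewrite ler_wpM2r //.
  by apply: sumr_ge0 => v _; rewrite divr_ge0 ?sqr_ge0 // ltW.
under eq_bigr => v _ do rewrite y1 mulr1.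
(* The weights [q u v] sum over [v] to at most 1 + 1, whence the factor 2 in the test. *)
rewrite big_split /= -mulr_suml sum_deg mulfV ?gt_eqF //.
by have := sum_Q u; lra.
Qed.

End Bias.
End TraceTest.

(** * Refuting XOR instances *)

Section PairTest.
Context {R : realFieldType} {m : nat} {V Gamma : finType}.
Variables (S : {set 'I_m}) (grp : 'I_m -> Gamma) (nu : Gamma -> R).
Variables (s1 s2 : 'I_m -> 'I_m -> V) (wt : 'I_m -> R).
Variables (M delta kappa d theta gamma : R) (p k : nat) (D : distribution R (cube m)).

Let mates i : {set 'I_m} := [set j in S | grp j == grp i].

Hypotheses (nu_gt0 : forall i, i \in S -> 0 < nu (grp i)) (wt_le1 : forall i, `|wt i| <= 1).
Hypotheses (M_gt0 : 0 < M) (delta_gt0 : 0 < delta).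
Hypotheses (S_le : #|S|%:R <= M) (nu_sum : \sum_(g in grp @: S) nu g <= 2 * M).
Hypothesis nu_diag : \sum_(i in S) (nu (grp i))^-1 <= delta ^+ 2 * M / 4.
Hypothesis nu_mates : forall i, i \in S -> #|mates i|%:R <= nu (grp i).
Hypothesis kappa_l : forall i v, i \in S ->
  #|[set j in mates i | s1 i j == v]|%:R <= kappa * nu (grp i) /\
  #|[set j in mates i | s2 i j == v]|%:R <= kappa * nu (grp i).
Hypothesis kappa_r : forall i v, i \in S ->
  #|[set j in mates i | s1 j i == v]|%:R <= kappa * nu (grp i) /\
  #|[set j in mates i | s2 j i == v]|%:R <= kappa * nu (grp i).
Hypotheses (kappa_ge0 : 0 <= kappa) (d_gt0 : 0 < d) (d_le : #|V|%:R * d <= M).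
Hypotheses (theta_gt0 : 0 < theta) (theta_le1 : theta <= 1).
Hypothesis kappa_small : (16 * p)%:R * kappa <= theta ^+ 4 * d.
Hypotheses (bias : biased gamma D) (gamma_ge0 : 0 <= gamma).
Hypotheses (V_gt0 : (0 < #|V|)%N) (pE : p = (2 ^ k)%N).

(** An edge is an ordered pair of outputs together with an orientation; [rev] flips the orientation
    and keeps the pair, hence also the labels and weights. *)
Let E : finType := ('I_m * 'I_m * bool)%type.
Let ok i j := [&& i \in S, j \in mates i & i != j].
Let cc i j : R := if ok i j then (nu (grp i))^-1 else 0.
Let c (e : E) : R := cc e.1.1 e.1.2.
Let w (e : E) : R := wt e.1.1 * wt e.1.2 * c e.
Let src (e : E) : V := if e.2 then s2 e.1.1 e.1.2 else s1 e.1.1 e.1.2.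
Let dst (e : E) : V := if e.2 then s1 e.1.1 e.1.2 else s2 e.1.1 e.1.2.
Let rev (e : E) : E := (e.1, ~~ e.2).
Let l1 (e : E) : 'I_m := e.1.1.
Let l2 (e : E) : 'I_m := e.1.2.

Let cc_ge0 i j : 0 <= cc i j.
Proof.
rewrite /cc; case: ifP => // /and3P[iS _ _].
by rewrite invr_ge0 ltW // nu_gt0.
Qed.

Let cc_sym i j : cc i j = cc j i.
Proof.
rewrite /cc /ok !inE (eq_sym j) (eq_sym (grp j)).
case: (i \in S); case: (j \in S) => //=.
by case: eqP => [->|//].
Qed.

Let sumE (F : E -> R) : \sum_e F e = \sum_i \sum_j (F (i, j, true) + F (i, j, false)).
Proof.
have -> : \sum_e F e = \sum_(e : E) F (e.1, e.2) by apply: eq_bigr => -[ij b].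
rewrite -(pair_bigA _ (fun ij b => F (ij, b))) /=.
have -> : \sum_ij \sum_b F (ij, b) = \sum_(ij : 'I_m * 'I_m) \sum_b F (ij.1, ij.2, b).
  by apply: eq_bigr => -[i j].
rewrite -(pair_bigA _ (fun i j => \sum_b F (i, j, b))) /=.
by apply: eq_bigr => i _; apply: eq_bigr => j _; rewrite big_bool.
Qed.

Let cc_mass i (f : 'I_m -> V) v :
  (i \in S -> #|[set j in mates i | f j == v]|%:R <= kappa * nu (grp i)) ->
  \sum_j (f j == v)%:R * cc i j <= kappa.
Proof.
move=> h; have [iS|iS] := boolP (i \in S); last first.
  by rewrite big1 // => j _; rewrite /cc /ok (negbTE iS) mulr0.
apply: (@le_trans _ _ (\sum_(j in [set j in mates i | f j == v]) (nu (grp i))^-1)).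
  rewrite [leRHS]big_mkcond; apply: ler_sum => j _ /=.
  have -> : (j \in [set j0 in mates i | f j0 == v]) = (j \in mates i) && (f j == v).
    by rewrite !inE.
  rewrite /cc /ok iS /=.
  have n0 : 0 <= (nu (grp i))^-1 by rewrite invr_ge0 ltW // nu_gt0.
  case: (j \in mates i) => /=; last by rewrite mulr0.
  case: eqP => _ /=; last by rewrite mul0r.
  by case: eqP => _ /=; rewrite ?mulr0 ?mul1r.
rewrite sumr_const -mulr_natl ler_pdivrMr ?nu_gt0 //.
exact: h.
Qed.

(** Each output in the support of [X] can be the first or the second label, in either orientation.
    Each of these four cases has mass at most [kappa] at [u]. *)
Let touched_mass (X : {ffun 'I_m -> bool}) u :
  \sum_(e | (src e == u) && (X (l1 e) || X (l2 e))) c e <= (weight X)%:R * (4 * kappa).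
Proof.
rewrite big_mkcond /= sumE.
apply: (@le_trans _ _
  (\sum_i \sum_j (X i)%:R * ((s2 i j == u)%:R * cc i j + (s1 i j == u)%:R * cc i j) +
   \sum_j \sum_i (X j)%:R * ((s2 i j == u)%:R * cc j i + (s1 i j == u)%:R * cc j i))).
  rewrite [X in _ <= _ + X]exchange_big -big_split; apply: ler_sum => i _ /=.
  rewrite -big_split; apply: ler_sum => j _ /=.
  rewrite -(cc_sym i j) /src /c /l1 /l2 /=; have := cc_ge0 i j.
  by case: (s2 i j == u); case: (s1 i j == u); case: (X i); case: (X j) => /=; lra.
rewrite /weight natr_sum mulr_suml -big_split; apply: ler_sum => i _ /=.
rewrite -!mulr_sumr -mulrDr ler_wpM2l // !big_split /=.
have h1 := @cc_mass i (s1 i) u (fun iS => proj1 (kappa_l u iS)).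
have h2 := @cc_mass i (s2 i) u (fun iS => proj2 (kappa_l u iS)).
have h3 := @cc_mass i (s1^~ i) u (fun iS => proj1 (kappa_r u iS)).
have h4 := @cc_mass i (s2^~ i) u (fun iS => proj2 (kappa_r u iS)).
by move: h1 h2 h3 h4 => /=; lra.
Qed.

Let sum_c : \sum_e c e <= 2 * M.
Proof.
rewrite sumE /c /=; apply: (@le_trans _ _ (\sum_(i in S) 2)).
  rewrite [leRHS]big_mkcond; apply: ler_sum => i _.
  case: ifP => iS; last first.
    by rewrite big1 // => j _; rewrite /cc /ok iS /= addr0.
  have -> : \sum_j (cc i j + cc i j) = 2 * \sum_j cc i j.
    by rewrite mulr_sumr; apply: eq_bigr => j _; ring.
  rewrite ler_piMr //.
  apply: (@le_trans _ _ (\sum_(j in mates i) (nu (grp i))^-1)).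
    rewrite [leRHS]big_mkcond; apply: ler_sum => j _; rewrite /cc /ok iS /=.
    have n0 : 0 <= (nu (grp i))^-1 by rewrite invr_ge0 ltW // nu_gt0.
    by case: (j \in mates i) => //=; case: ifP.
  by rewrite sumr_const -mulr_natl ler_pdivrMr ?nu_gt0 // mul1r nu_mates.
by rewrite sumr_const -[leLHS]mulr_natr ler_pM2l // ltr0n.
Qed.

(** Cauchy-Schwarz over the groups with weights [nu] gives [(delta * M) ^+ 2 <= 2 * M * (dg + off)].
    The diagonal [dg] takes at most half of the resulting [delta ^+ 2 * M / 2]. *)
Let pair_sum (a : 'I_m -> R) : (forall i, a i ^+ 2 <= 1) ->
  delta * M <= `|\sum_(i in S) a i| ->
  delta ^+ 2 * M / 4 <= \sum_i \sum_j cc i j * (a i * a j).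
Proof.
move=> a1 ha.
set Z := fun g => \sum_(i in S | grp i == g) a i.
have cs := @cauchy_schwarz R Gamma (fun g => if g \in grp @: S then nu g else 0)
  (fun=> 1) (fun g => Z g / nu g).
have {}cs := cs _; have {cs} /cs : forall g, 0 <= (if g \in grp @: S then nu g else 0).
  by move=> g; case: ifP => // /imsetP[i iS ->]; rewrite ltW // nu_gt0.
have -> : \sum_g (if g \in grp @: S then nu g else 0) * 1 * (Z g / nu g) = \sum_(i in S) a i.
  rewrite (partition_big grp (mem (grp @: S))) /=; last by move=> i iS; rewrite imset_f.
  rewrite [RHS]big_mkcond; apply: eq_bigr => g _ /=.
  case: ifP => [/imsetP[i iS ->]|_]; last by rewrite !mul0r.
  by rewrite mulr1 mulrCA mulfV ?mulr1 // gt_eqF // nu_gt0.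
have -> : \sum_g (if g \in grp @: S then nu g else 0) * 1 ^+ 2 = \sum_(g in grp @: S) nu g.
  by rewrite [RHS]big_mkcond; apply: eq_bigr => g _; rewrite expr1n mulr1.
have -> : \sum_g (if g \in grp @: S then nu g else 0) * (Z g / nu g) ^+ 2 =
    \sum_(i in S) (nu (grp i))^-1 * a i ^+ 2 + \sum_i \sum_j cc i j * (a i * a j).
  transitivity (\sum_(i in S) \sum_(j in mates i) (nu (grp i))^-1 * (a i * a j)).
    rewrite [RHS](partition_big grp (mem (grp @: S))) /=; last by move=> i iS; rewrite imset_f.
    rewrite [RHS]big_mkcond; apply: eq_bigr => g _ /=.
    case: ifP => [gS|_]; last by rewrite mul0r.
    have n0 : nu g != 0 by case/imsetP: gS => i iS ->; rewrite gt_eqF // nu_gt0.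
    transitivity ((nu g)^-1 * (Z g * Z g)); first by field.
    rewrite {1}/Z mulr_suml mulr_sumr; apply: eq_bigr => i /andP[iS /eqP gi].
    rewrite mulr_sumr mulr_sumr gi; apply: eq_bigl => j.
    by rewrite inE gi.
  rewrite big_mkcond [X in _ = X + _]big_mkcond -big_split; apply: eq_bigr => i _ /=.
  case: ifP => iS; last by rewrite add0r big1 // => j _; rewrite /cc /ok iS mul0r.
  rewrite (bigD1 i) /=; last by rewrite inE iS eqxx.
  rewrite -expr2; congr (_ + _); rewrite big_mkcond; apply: eq_bigr => j _.
  by rewrite /cc /ok iS /= eq_sym; case: ifP => _; rewrite ?mul0r.
move=> cs.
have diag : \sum_(i in S) (nu (grp i))^-1 * a i ^+ 2 <= delta ^+ 2 * M / 4.
  apply: le_trans nu_diag; apply: ler_sum => i iS.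
  by rewrite ler_piMr // invr_ge0 ltW // nu_gt0.
have dM : 0 <= delta * M by rewrite ltW // mulr_gt0.
have sq : (delta * M) ^+ 2 <= (\sum_(i in S) a i) ^+ 2.
  by rewrite -[leRHS]real_normK ?num_real // ler_sqr ?nnegrE.
have {}cs := le_trans sq cs.
set off := \sum_i _ in cs *; set dg := \sum_(i in S) _ in cs diag.
have : (delta * M) ^+ 2 <= 2 * M * (dg + off).
  (* Replacing the sum of [nu] by [2 * M] needs a nonnegative cofactor; a negative one would force a
     positive square below 0. *)
  have [pos|neg] := lerP 0 (dg + off).
    by apply: le_trans cs _; rewrite ler_wpM2r.
  have : (delta * M) ^+ 2 <= 0.
    apply: le_trans cs _; rewrite mulr_ge0_le0 ?(ltW neg) //.
    by apply: sumr_ge0 => g /imsetP[i iS ->]; rewrite ltW // nu_gt0.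
  by rewrite leNgt exprn_gt0 // mulr_gt0.
move=> h; suff : delta ^+ 2 * M <= 2 * (dg + off) by lra.
rewrite -(ler_pM2l M_gt0).
have -> : M * (delta ^+ 2 * M) = (delta * M) ^+ 2 by ring.
by rewrite mulrA [M * 2]mulrC.
Qed.

(** Multiplying two terms of one group eliminates the unknown sign attached to the group. What is
    left factors over the two ends of an edge, as the trace test requires. *)
Lemma pair_test :
  exists Phi : {ffun 'I_m -> bool} -> R, [/\ forall b, 0 <= Phi b,
    expect D Phi <= 2 * (delta ^+ 2 / 8) ^- (2 * p) *
      (gamma + #|V|%:R * (2 * theta ^+ 2) ^+ (2 * p)) &
    forall (b : {ffun 'I_m -> bool}) (xi : 'I_m -> R) (y : V -> R),
      (forall i, xi i ^+ 2 = 1) -> (forall v, y v ^+ 2 = 1) ->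
      (forall i j, i \in S -> j \in S -> grp i = grp j ->
         xi i * xi j = y (s1 i j) * y (s2 i j)) ->
      delta * M <= `|\sum_(i in S) wt i * (-1) ^+ b i * xi i| -> 1 <= Phi b].
Proof.
have revK : involutive rev by move=> -[ij b]; rewrite /rev /= negbK.
have src_rev e : src (rev e) = dst e by rewrite /src /dst; case: e => -[i j []].
have wc e : `|w e| <= c e.
  rewrite /w !normrM [`|c e|]ger0_norm ?cc_ge0 //.
  by rewrite ler_piMl ?cc_ge0 // mulr_ile1.
have l12 e : c e != 0 -> l1 e != l2 e.
  by rewrite /c /cc; case: ifP => [/and3P[]//|_]; rewrite eqxx.
have ks : (4 * p)%:R * (4 * kappa) <= theta ^+ 4 * d.
  by apply: le_trans kappa_small; rewrite mulrA -natrM mulnAC.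
have l1r e : l1 (rev e) = l1 e by [].
have l2r e : l2 (rev e) = l2 e by [].
have cr e : c (rev e) = c e by [].
have wr e : w (rev e) = w e by [].
have k4 : 0 <= 4 * kappa by rewrite mulr_ge0.
have eta0 : 0 < delta ^+ 2 / 8 by rewrite divr_gt0 ?exprn_gt0 // ltr0n.
have [Phi [P0 PE P1]] := @trace_test R m V E src dst rev l1 l2 c w d theta (4 * kappa) p
  revK src_rev l1r l2r cr wr wc l12 d_gt0
  theta_gt0 theta_le1 touched_mass k4 ks D gamma bias gamma_ge0 _ k V_gt0 eta0 pE.
exists Phi; split=> // b xi y xi1 y1 xiy h; apply: (P1 b y y1).
set a := fun i => wt i * (-1) ^+ b i * xi i.
have a1 i : a i ^+ 2 <= 1.
  rewrite /a !exprMn xi1 mulr1 sqrr_sign mulr1.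
  by rewrite -[leLHS]real_normK ?num_real // expr_le1.
have := pair_sum a1 h.
have -> : \sum_e w e * char (unitv (l1 e) + unitv (l2 e)) b * (y (src e) * y (dst e)) =
    2 * \sum_i \sum_j cc i j * (a i * a j).
  rewrite sumE mulr_sumr; apply: eq_bigr => i _; rewrite mulr_sumr; apply: eq_bigr => j _.
  rewrite /w /c /l1 /l2 /src /dst /= charD !char_unitv.
  have [okij|/negbTE nok] := boolP (ok i j); last by rewrite /cc nok !(mulr0, mul0r, addr0).
  have : xi i * xi j = y (s1 i j) * y (s2 i j).
    by case/and3P: okij => iS; rewrite inE => /andP[jS /eqP] ? _; apply: xiy.
  have -> : cc i j * (a i * a j) =
     cc i j * wt i * wt j * (-1) ^+ b i * (-1) ^+ b j * (xi i * xi j) by rewrite /a; ring.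
  by move=> ->; ring.
have := sum_c; set off := \sum_i _ => hc ho.
(* The total degree is at most [3 * M] and the form is at least [delta ^+ 2 * M / 2], so the ratio
   [delta ^+ 2 / 8] is safe. *)
apply: (@le_trans _ _ (delta ^+ 2 / 8 * (2 * M + M))).
  by rewrite ler_pM2l // lerD.
by move: ho; have := mulr_gt0 (exprn_gt0 2 delta_gt0) M_gt0; lra.
Qed.

End PairTest.

Section XorTest.
Context {R : realFieldType} {m : nat}.
Variables (J : {set 'I_m}) (wt : 'I_m -> R).
Variables (delta tau theta gamma : R) (p k : nat) (D : distribution R (cube m)).

Let M : R := #|J|%:R.

Hypotheses (wt_le1 : forall i, `|wt i| <= 1) (M_gt0 : 0 < M) (delta_gt0 : 0 < delta).
Hypotheses (tau_gt0 : 0 < tau) (tau_large : 4 <= tau * delta ^+ 2).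
Hypotheses (theta_gt0 : 0 < theta) (theta_le1 : theta <= 1).
Hypotheses (bias : biased gamma D) (gamma_ge0 : 0 <= gamma) (pE : p = (2 ^ k)%N).

Let fiber (K : finType) (key : 'I_m -> K) g : {set 'I_m} := [set j in J | key j == g].

Let sum_fiber (K : finType) (key : 'I_m -> K) : \sum_g #|fiber key g|%:R = M.
Proof.
rewrite /M -natr_sum; congr (_%:R); rewrite -sum1_card (partition_big key predT) //=.
by apply: eq_bigr => g _; rewrite -sum1_card; apply: eq_bigl => j; rewrite inE.
Qed.

(** Groups are the classes of [key], and the edge of [i], [j] joins [res i] to [res j]. Classes of
    size at least [tau] number at most [M / tau], which bounds the diagonal; [V] is so small that
    [kappa = 1] is affordable. *)
Lemma heavy_test (V K : finType) (key : 'I_m -> K) (res : 'I_m -> V) (S : {set 'I_m}) :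
  (0 < #|V|)%N -> (16 * p)%:R * #|V|%:R <= theta ^+ 4 * M -> S \subset J ->
  (forall i, i \in S -> tau <= #|[set j in J | key j == key i]|%:R) ->
  exists Phi : {ffun 'I_m -> bool} -> R, [/\ forall b, 0 <= Phi b,
    expect D Phi <= 2 * (delta ^+ 2 / 8) ^- (2 * p) *
      (gamma + #|V|%:R * (2 * theta ^+ 2) ^+ (2 * p)) &
    forall (b : {ffun 'I_m -> bool}) (alpha : K -> R) (beta : V -> R),
      (forall g, alpha g ^+ 2 = 1) -> (forall v, beta v ^+ 2 = 1) ->
      delta * M <= `|\sum_(i in S) wt i * (-1) ^+ b i * (alpha (key i) * beta (res i))| ->
      1 <= Phi b].
Proof.
move=> V0 pV SJ heavy.
have n0 : 0 < #|V|%:R :> R by rewrite ltr0n.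
pose nu g : R := #|fiber key g|%:R.
have nu_heavy i : i \in S -> tau <= nu (key i) by exact: heavy.
have nu_gt0 i : i \in S -> 0 < nu (key i) by move/nu_heavy; apply: lt_le_trans.
have nu_sum : \sum_(g in key @: S) nu g <= M.
  rewrite -(sum_fiber key) [leLHS]big_mkcond; apply: ler_sum => g _.
  by case: ifP => // _; apply: ler0n.
have nu_mates i : #|[set j in S | key j == key i]|%:R <= nu (key i).
  rewrite ler_nat subset_leq_card //; apply/subsetP => j; rewrite !inE => /andP[jS ->].
  by rewrite (subsetP SJ).
have nu_diag : \sum_(i in S) (nu (key i))^-1 <= delta ^+ 2 * M / 4.
  apply: (@le_trans _ _ #|key @: S|%:R).
    rewrite (partition_big key (mem (key @: S))) /=; last by move=> i iS; rewrite imset_f.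
    rewrite -sum1_card natr_sum; apply: ler_sum => g /imsetP[i iS ->].
    rewrite (eq_bigr (fun=> (nu (key i))^-1)); last by move=> j /andP[_ /eqP ->].
    rewrite sumr_const -[leLHS]mulr_natl ler_pdivrMr ?nu_gt0 // mul1r.
    apply: le_trans (nu_mates i); rewrite ler_nat subset_leq_card //.
    by apply/subsetP => j; rewrite !inE.
  have : tau * #|key @: S|%:R <= M.
    apply: le_trans nu_sum; rewrite mulr_natr -sumr_const.
    by apply: ler_sum => g /imsetP[i iS ->]; apply: nu_heavy.
  set x := #|_|%:R; have x0 : 0 <= x by exact: ler0n.
  move=> h; have h1 : 4 * x <= tau * delta ^+ 2 * x by rewrite ler_wpM2r.
  have h2 : delta ^+ 2 * (tau * x) <= delta ^+ 2 * M by rewrite ler_wpM2l ?sqr_ge0.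
  by move: h1 h2; rewrite mulrA [delta ^+ 2 * tau]mulrC; lra.
have kap (i : 'I_m) (Q : pred 'I_m) : i \in S ->
    #|[set j in [set j in S | key j == key i] | Q j]|%:R <= 1 * nu (key i).
  move=> iS; rewrite mul1r; apply: le_trans (nu_mates i); rewrite ler_nat subset_leq_card //.
  by apply/subsetP => j; rewrite inE => /andP[].
have SM : #|S|%:R <= M by rewrite ler_nat subset_leq_card.
have nu_sum2 : \sum_(g in key @: S) nu g <= 2 * M.
  by apply: le_trans nu_sum _; rewrite mulr_natl mulr2n lerDl ltW.
have d0 : 0 < M / #|V|%:R by rewrite divr_gt0.
have dV : #|V|%:R * (M / #|V|%:R) <= M by rewrite mulrCA mulfV ?mulr1 // gt_eqF.
have small : (16 * p)%:R * 1 <= theta ^+ 4 * (M / #|V|%:R).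
  by rewrite mulr1 mulrA ler_pdivlMr.
have [Phi [P0 PE P1]] := @pair_test R m V K S key nu (fun i _ => res i) (fun _ j => res j) wt
  M delta 1 (M / #|V|%:R) theta gamma p k D nu_gt0 wt_le1 M_gt0 delta_gt0
  SM nu_sum2 nu_diag (fun i _ => nu_mates i)
  (fun i v iS => conj (kap i _ iS) (kap i _ iS)) (fun i v iS => conj (kap i _ iS) (kap i _ iS))
  ler01 d0 dV theta_gt0 theta_le1 small bias gamma_ge0 V0 pE.
exists Phi; split=> // b alpha beta a1 b1 h.
apply: (P1 b (fun i => alpha (key i) * beta (res i)) beta) => //.
  by move=> i; rewrite exprMn a1 b1 mul1r.
by move=> i j _ _ ij; rewrite ij mulrACA -expr2 a1 mul1r.
Qed.

(** Grouping by [u] alone leaves four factors per pair, so vertices are pairs of elements of [V].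
    For fixed [i], a vertex determines [a j] or [b j], and lightness leaves at most [tau] choices of
    [j]. *)
Lemma light_test (U V : finType) (u : 'I_m -> U) (a b : 'I_m -> V) (S : {set 'I_m}) :
  (0 < #|U|)%N -> (0 < #|V|)%N -> #|U|%:R <= delta ^+ 2 * M / 4 ->
  (16 * p)%:R * tau * #|U|%:R * #|V|%:R ^+ 2 <= theta ^+ 4 * M ^+ 2 -> S \subset J ->
  (forall i, i \in S -> #|[set j in J | (u j, a j) == (u i, a i)]|%:R <= tau) ->
  (forall i, i \in S -> #|[set j in J | (u j, b j) == (u i, b i)]|%:R <= tau) ->
  exists Phi : {ffun 'I_m -> bool} -> R, [/\ forall x, 0 <= Phi x,
    expect D Phi <= 2 * (delta ^+ 2 / 8) ^- (2 * p) *
      (gamma + #|V|%:R ^+ 2 * (2 * theta ^+ 2) ^+ (2 * p)) &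
    forall (x : {ffun 'I_m -> bool}) (alpha : U -> R) (beta : V -> R),
      (forall g, alpha g ^+ 2 = 1) -> (forall v, beta v ^+ 2 = 1) ->
      delta * M <= `|\sum_(i in S) wt i * (-1) ^+ x i *
        (alpha (u i) * beta (a i) * beta (b i))| ->
      1 <= Phi x].
Proof.
move=> U0 V0 PM pUV SJ lightA lightB.
have u0 : 0 < #|U|%:R :> R by rewrite ltr0n.
have v0 : 0 < #|V|%:R :> R by rewrite ltr0n.
have MU0 : 0 < M / #|U|%:R by rewrite divr_gt0.
(* The added average [M / #|U|] keeps sparse groups from getting large edge weights, and only
   doubles the total. *)
pose nu g : R := #|[set j in S | u j == g]|%:R + M / #|U|%:R.
have nu_gt0 g : 0 < nu g by rewrite ltr_wpDl // ler0n.
have SM : #|S|%:R <= M by rewrite ler_nat subset_leq_card.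
have sumS : \sum_g #|[set j in S | u j == g]|%:R = #|S|%:R :> R.
  rewrite -natr_sum; congr (_%:R); rewrite -sum1_card (partition_big u predT) //=.
  by apply: eq_bigr => g _; rewrite -sum1_card; apply: eq_bigl => j; rewrite inE.
have nu_sum : \sum_(g in u @: S) nu g <= 2 * M.
  apply: (@le_trans _ _ (\sum_g nu g)).
    rewrite [leLHS]big_mkcond; apply: ler_sum => g _.
    by case: ifP => // _; exact: ltW.
  rewrite big_split /= sumS sumr_const -[X in _ + X]mulr_natl mulrCA mulfV ?gt_eqF // mulr1.
  by rewrite mulr_natl mulr2n lerD2r.
have nu_mates i : #|[set j in S | u j == u i]|%:R <= nu (u i) by rewrite lerDl ltW.
have nu_diag : \sum_(i in S) (nu (u i))^-1 <= delta ^+ 2 * M / 4.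
  apply: le_trans PM; rewrite (partition_big u predT) //= -sum1_card natr_sum.
  apply: ler_sum => g _.
  rewrite (eq_bigr (fun=> (nu g)^-1)); last by move=> j /andP[_ /eqP ->].
  rewrite sumr_const -[leLHS]mulr_natl ler_pdivrMr // mul1r.
  rewrite /nu ler_wpDr ?(ltW MU0) // ler_nat subset_leq_card //.
  by apply/subsetP => j; rewrite !inE.
pose kappa := tau * #|U|%:R / M.
have tau_le g : tau <= kappa * nu g.
  apply: (@le_trans _ _ (kappa * (M / #|U|%:R))).
    by rewrite le_eqVlt; apply/orP; left; apply/eqP; rewrite /kappa; field; rewrite !gt_eqF.
  by rewrite ler_wpM2l ?lerDr ?ler0n // ?divr_ge0 ?mulr_ge0 ?ltW.
have card_le (c : 'I_m -> V) (X : {set 'I_m}) g v :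
    (forall i, i \in S -> #|[set j in J | (u j, c j) == (u i, c i)]|%:R <= tau) ->
    (forall j, j \in X -> [/\ j \in S, u j = g & c j = v]) -> #|X|%:R <= kappa * nu g.
  move=> light hX; apply: le_trans (tau_le g).
  have [->|[i iX]] := set_0Vmem X; first by rewrite cards0 ltW.
  have [iS ui ci] := hX _ iX.
  apply: le_trans (light _ iS); rewrite ler_nat subset_leq_card //.
  apply/subsetP => j /hX[jS uj cj]; rewrite inE uj cj ui ci eqxx andbT.
  exact: (subsetP SJ).
(* The two [a] factors go to one end and the two [b] factors to the other, so either end alone pins
   down a class [(u, a)] or [(u, b)]. *)
pose s1 i j := (a i, a j); pose s2 i j := (b i, b j).
have kl i v : i \in S ->
    #|[set j in [set j in S | u j == u i] | s1 i j == v]|%:R <= kappa * nu (u i) /\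
    #|[set j in [set j in S | u j == u i] | s2 i j == v]|%:R <= kappa * nu (u i).
  move=> iS; split.
    apply: (@card_le a _ _ v.2) => // j; rewrite !inE.
    by move=> /andP[/andP[jS /eqP uj] /eqP <-].
  apply: (@card_le b _ _ v.2) => // j; rewrite !inE.
  by move=> /andP[/andP[jS /eqP uj] /eqP <-].
have kr i v : i \in S ->
    #|[set j in [set j in S | u j == u i] | s1 j i == v]|%:R <= kappa * nu (u i) /\
    #|[set j in [set j in S | u j == u i] | s2 j i == v]|%:R <= kappa * nu (u i).
  move=> iS; split.
    apply: (@card_le a _ _ v.1) => // j; rewrite !inE.
    by move=> /andP[/andP[jS /eqP uj] /eqP <-].
  apply: (@card_le b _ _ v.1) => // j; rewrite !inE.
  by move=> /andP[/andP[jS /eqP uj] /eqP <-].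
have cV : #|{: V * V}|%:R = #|V|%:R ^+ 2 :> R by rewrite card_prod natrM expr2.
have VV0 : (0 < #|{: V * V}|)%N by rewrite card_prod muln_gt0 V0.
have k0 : 0 <= kappa by rewrite divr_ge0 ?mulr_ge0 ?ltW.
have d0 : 0 < M / #|V|%:R ^+ 2 by rewrite divr_gt0 // exprn_gt0.
have dV : #|{: V * V}|%:R * (M / #|V|%:R ^+ 2) <= M.
  by rewrite cV mulrCA mulfV ?mulr1 // gt_eqF // exprn_gt0.
have small : (16 * p)%:R * kappa <= theta ^+ 4 * (M / #|V|%:R ^+ 2).
  rewrite /kappa !mulrA ler_pdivlMr ?exprn_gt0 //.
  by rewrite mulrAC ler_pdivrMr // -[leRHS]mulrA -expr2.
have [Phi [P0 PE P1]] := @pair_test R m (V * V)%type U S u nu s1 s2 wt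
  M delta kappa (M / #|V|%:R ^+ 2) theta gamma p k D (fun i _ => nu_gt0 (u i)) wt_le1 M_gt0
  delta_gt0 SM nu_sum nu_diag (fun i _ => nu_mates i) kl kr
  k0 d0 dV theta_gt0 theta_le1 small bias gamma_ge0 VV0 pE.
exists Phi; split=> //; first by rewrite -cV.
move=> x alpha beta a1 b1 h.
apply: (P1 x (fun i => alpha (u i) * beta (a i) * beta (b i))
  (fun v => beta v.1 * beta v.2)) => //.
- by move=> i; rewrite !exprMn a1 !b1 !mul1r.
- by move=> v; rewrite exprMn !b1 mul1r.
- move=> i j _ _ ij; rewrite ij /=.
  transitivity (alpha (u j) ^+ 2 *
    (beta (a i) * beta (a j) * (beta (b i) * beta (b j)))); first by ring.
  by rewrite a1 mul1r.
Qed.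

(** [J] splits into outputs with heavy [(u, a)], those with only [(u, b)] heavy, and those with both
    light. A sum of size [3 * delta * M] is at least [delta * M] on one part, so the three tests are
    added. *)
Lemma xor_test (U V : finType) (u : 'I_m -> U) (a b : 'I_m -> V) :
  (0 < #|U|)%N -> (0 < #|V|)%N -> #|U|%:R <= delta ^+ 2 * M / 4 ->
  (16 * p)%:R * #|V|%:R <= theta ^+ 4 * M ->
  (16 * p)%:R * tau * #|U|%:R * #|V|%:R ^+ 2 <= theta ^+ 4 * M ^+ 2 ->
  exists Phi : {ffun 'I_m -> bool} -> R, [/\ forall x, 0 <= Phi x,
    expect D Phi <= 3 * (2 * (delta ^+ 2 / 8) ^- (2 * p) *
      (gamma + #|V|%:R ^+ 2 * (2 * theta ^+ 2) ^+ (2 * p))) &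
    forall (x : {ffun 'I_m -> bool}) (alpha : U -> R) (beta : V -> R),
      (forall g, alpha g ^+ 2 = 1) -> (forall v, beta v ^+ 2 = 1) ->
      3 * delta * M <= `|\sum_(i in J) wt i * (-1) ^+ x i *
        (alpha (u i) * beta (a i) * beta (b i))| ->
      1 <= Phi x].
Proof.
move=> U0 V0 PM pV pUV.
pose hA i := tau <= #|[set j in J | (u j, a j) == (u i, a i)]|%:R.
pose hB i := tau <= #|[set j in J | (u j, b j) == (u i, b i)]|%:R.
pose SA := [set i in J | hA i].
pose SB := [set i in J | ~~ hA i & hB i].
pose SL := [set i in J | ~~ hA i & ~~ hB i].
have [|i|PA [A0 AE A1]] := @heavy_test V (U * V)%type (fun i => (u i, a i)) b SA V0 pV.
- by apply/subsetP => i; rewrite inE => /andP[].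
- by rewrite inE => /andP[].
have [|i|PB [B0 BE B1]] := @heavy_test V (U * V)%type (fun i => (u i, b i)) a SB V0 pV.
- by apply/subsetP => i; rewrite inE => /andP[].
- by rewrite inE => /and3P[].
have [|i|i|PL [L0 LE L1]] := @light_test U V u a b SL U0 V0 PM pUV.
- by apply/subsetP => i; rewrite inE => /andP[].
- by rewrite inE => /and3P[_ h _]; rewrite ltW // ltNge.
- by rewrite inE => /and3P[_ _ h]; rewrite ltW // ltNge.
exists (fun x => PA x + PB x + PL x); split=> [x||x alpha beta a1 b1 h].
- by rewrite !addr_ge0.
- have -> : expect D (fun x => PA x + PB x + PL x) = expect D PA + expect D PB + expect D PL.
    by rewrite -!big_split; apply: eq_bigr => x _; rewrite !mulrDr.
  set e0 := 2 * _; have e00 : 0 <= e0.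
    by rewrite mulr_ge0 // invr_ge0 exprn_ge0 // divr_ge0 // exprn_ge0 // ltW.
  set e1 := (2 * theta ^+ 2) ^+ _ in AE BE LE *.
  have VV : e0 * (gamma + #|V|%:R * e1) <= e0 * (gamma + #|V|%:R ^+ 2 * e1).
    have e10 : 0 <= e1 by rewrite exprn_ge0 // mulr_ge0 // exprn_ge0 // ltW.
    rewrite ler_wpM2l // lerD2l ler_wpM2r //.
    by rewrite -natrX ler_nat leq_pmulr.
  have := le_trans AE VV; have := le_trans BE VV; move: LE; rewrite -/e0.
  by set z := e0 * (gamma + #|V|%:R ^+ 2 * e1); lra.
pose F i := wt i * (-1) ^+ x i * (alpha (u i) * beta (a i) * beta (b i)).
have split_sum : \sum_(i in J) F i =
    \sum_(i in SA) F i + \sum_(i in SB) F i + \sum_(i in SL) F i.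
  rewrite big_mkcond [X in _ = X + _ + _]big_mkcond [X in _ = _ + X + _]big_mkcond.
  rewrite [X in _ = _ + _ + X]big_mkcond -!big_split; apply: eq_bigr => i _ /=.
  by rewrite !inE; case: (i \in J); case: (hA i); case: (hB i); rewrite /= ?addr0 ?add0r.
have pairing g : (alpha g.1 * beta g.2) ^+ 2 = 1 by rewrite exprMn a1 b1 mul1r.
have EA : \sum_(i in SA) F i = \sum_(i in SA) wt i * (-1) ^+ x i *
    ((fun g : U * V => alpha g.1 * beta g.2) (u i, a i) * beta (b i)) by [].
have EB : \sum_(i in SB) F i = \sum_(i in SB) wt i * (-1) ^+ x i *
    ((fun g : U * V => alpha g.1 * beta g.2) (u i, b i) * beta (a i)).
  by apply: eq_bigr => i _; rewrite /F /= [_ * _ * beta (b i)]mulrAC.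
have := A1 x (fun g => alpha g.1 * beta g.2) beta pairing b1; rewrite -EA => hA1.
have := B1 x (fun g => alpha g.1 * beta g.2) beta pairing b1; rewrite -EB => hB1.
have hL1 := L1 x alpha beta a1 b1.
have PA0 := A0 x; have PB0 := B0 x; have PL0 := L0 x.
have [/hA1|lA] := lerP (delta * M) `|\sum_(i in SA) F i|; first by lra.
have [/hB1|lB] := lerP (delta * M) `|\sum_(i in SB) F i|; first by lra.
have [/hL1|lL] := lerP (delta * M) `|\sum_(i in SL) F i|; first by lra.
move: h; rewrite split_sum -mulrA => h.
have := ler_normD (\sum_(i in SA) F i + \sum_(i in SB) F i) (\sum_(i in SL) F i).
have := ler_normD (\sum_(i in SA) F i) (\sum_(i in SB) F i).
by lra.
Qed.

End XorTest.

(** * Local functions *)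

Definition restrict (n t : nat) (h : 'I_t -> 'I_n) (x : {ffun 'I_n -> bool}) :
  {ffun 'I_t -> bool} := [ffun k => x (h k)].

Lemma local_repr (n t : nat) (f : cube n -> bool) : (0 < n)%N ->
  depends_on_at_most t f ->
  exists hF : ('I_t -> 'I_n) * ({ffun 'I_t -> bool} -> bool),
    forall x, f x = hF.2 (restrict hF.1 x).
Proof.
(* The coordinate [x0] pads the enumeration of [S] to length [t]; [ext] rebuilds an input that
   agrees with [x] on [S]. *)
move=> n0 [S St fS]; pose x0 := Ordinal n0.
pose h (k : 'I_t) := nth x0 (enum S) k.
pose ext (z : {ffun 'I_t -> bool}) : {ffun 'I_n -> bool} :=
  [ffun j => if insub (index j (enum S)) is Some k then z k else false].
exists (h, f \o ext) => x; apply: fS => j jS /=.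
have jt : (index j (enum S) < t)%N.
  by apply: leq_trans St; rewrite cardE index_mem mem_enum.
by rewrite ffunE insubT /= ffunE /h /= nth_index // mem_enum.
Qed.

Section Slots.
Context {R : realFieldType}.

(** [None] is an empty slot of sign 1, so that products of at most [r] signs are indexed by one type
    with [n.+1 ^ r] elements. *)
Definition osign (n : nat) (x : {ffun 'I_n -> bool}) (o : option 'I_n) : R :=
  if o is Some j then (-1) ^+ x j else 1.

Definition fsign (n r : nat) (x : {ffun 'I_n -> bool}) (g : {ffun 'I_r -> option 'I_n}) : R :=
  \prod_k osign x (g k).

Lemma fsign_sqr n r x (g : {ffun 'I_r -> option 'I_n}) : fsign x g ^+ 2 = 1.
Proof.
rewrite /fsign -prodrXl big1 // => k _.
by case: (g k) => [j|] /=; rewrite ?sqrr_sign ?expr1n.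
Qed.

Lemma prod_onth (T : Type) (f : option T -> R) (s : seq T) q : f None = 1 ->
  (size s <= q)%N -> \prod_(k < q) f (onth s k) = \prod_(a <- s) f (Some a).
Proof.
move=> f1; elim: s q => [|a s IH] [|q] //= hs.
- by rewrite big_ord0 big_nil.
- by rewrite big_nil big1 // => k _; rewrite onth0n.
- by rewrite big_ord_recl big_cons; congr (_ * _); apply: IH.
Qed.

Lemma char_slots (t q : nat) (Z : {ffun 'I_t -> bool}) : (#|[set k | Z k]| <= q)%N ->
  exists slot : 'I_q -> option 'I_t, forall (n : nat) (h : 'I_t -> 'I_n) x,
    char Z (restrict h x) = \prod_k osign x (omap h (slot k)).
Proof.
move=> Zq; exists (fun k : 'I_q => onth (enum [set k | Z k]) k) => n h x.
rewrite (@prod_onth _ (fun o => osign x (omap h o))) ?cardE //; last by rewrite -cardE.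
rewrite big_enum /= big_mkcond; apply: eq_bigr => k _.
by rewrite inE /restrict ffunE; case: (Z k).
Qed.

(** The positions of [Z] are listed, padded and cut into blocks of length [e], [r], [r]. The cut is
    chosen before [h], hence is common to all outputs. *)
Lemma char_split (t e r : nat) (Z : {ffun 'I_t -> bool}) :
  (#|[set k | Z k]| <= e + (r + r))%N ->
  exists (u : forall n, ('I_t -> 'I_n) -> {ffun 'I_e -> option 'I_n})
    (a b : forall n, ('I_t -> 'I_n) -> {ffun 'I_r -> option 'I_n}),
  forall (n : nat) (h : 'I_t -> 'I_n) x,
    char Z (restrict h x) = fsign x (u n h) * fsign x (a n h) * fsign x (b n h).
Proof.
move=> /char_slots[slot slotE].
exists (fun n h => [ffun k => omap h (slot (lshift _ k))]).
exists (fun n h => [ffun k => omap h (slot (rshift _ (lshift _ k)))]).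
exists (fun n h => [ffun k => omap h (slot (rshift _ (rshift _ k)))]).
move=> n h x; rewrite slotE big_split_ord big_split_ord /= /fsign mulrA.
by congr (_ * _ * _); apply: eq_bigr => k _; rewrite ffunE.
Qed.

End Slots.

Section Local.
Context {R : realFieldType}.

Definition onesv (t : nat) : {ffun 'I_t -> bool} := [ffun=> true].

Definition is_xor (t : nat) (F : {ffun 'I_t -> bool} -> bool) : bool :=
  [exists s : bool, forall z, (-1) ^+ F z == (-1) ^+ s * char (onesv t) z :> R].

Lemma fourier_le1 (t : nat) (F : {ffun 'I_t -> bool} -> bool) Z :
  `|fourier (fun z => (-1) ^+ F z) Z| <= 1 :> R.
Proof.
have t0 : 0 < 2 ^+ t :> R by rewrite exprn_gt0.
rewrite /fourier normrM normfV (gtr0_norm t0) mulrC ler_pdivrMr // mul1r.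
apply: le_trans (ler_norm_sum _ _ _) _.
under eq_bigr => z _ do rewrite normrM norm_char mulr1 normr_sign.
by rewrite sumr_const card_ffun card_bool card_ord natrX.
Qed.

(** [F] differs somewhere from the full parity and somewhere from its negation. Each disagreement
    lowers the corresponding signed sum of [2 ^+ t] terms by at least 2. *)
Lemma fourier_ones (t : nat) (F : {ffun 'I_t -> bool} -> bool) : ~~ is_xor F ->
  `|fourier (fun z => (-1) ^+ F z) (onesv t)| <= 1 - 2 * 2 ^- t :> R.
Proof.
move=> nF.
have t0 : 0 < 2 ^+ t :> R by rewrite exprn_gt0.
have cardS : \sum_(z : {ffun 'I_t -> bool}) 1 = 2 ^+ t :> R.
  by rewrite sumr_const card_ffun card_bool card_ord natrX.
pose g z : R := (-1) ^+ F z * char (onesv t) z.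
have g1 z : `|g z| = 1 by rewrite normrM norm_char normr_sign mulr1.
have key (s : bool) : (-1) ^+ s * \sum_z g z <= 2 ^+ t - 2.
  move: nF; rewrite negb_exists => /forallP/(_ s); rewrite negb_forall => /existsP[z hz].
  rewrite -cardS mulr_sumr (bigD1 z) //= [X in _ <= X - 2](bigD1 z) //=.
  have -> : (-1) ^+ s * g z = -1.
    rewrite /g; move: hz; have [a ->] := @char_sign R t (onesv t) z.
    by case: (F z); case: s; case: a => /=;
      rewrite ?expr0 ?expr1 ?mulr1 ?mul1r ?mulrNN ?opprK ?mulr1 ?mulN1r ?opprK ?eqxx.
  have : \sum_(i | i != z) (-1) ^+ s * g i <= \sum_(i | i != z) 1.
    apply: ler_sum => i _; apply: le_trans (ler_norm _) _.
    by rewrite normrM normr_sign g1 mulr1.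
  by lra.
rewrite /fourier normrM normfV (gtr0_norm t0) mulrC ler_pdivrMr // mulrBl mul1r.
rewrite -mulrA mulVf ?mulr1 ?gt_eqF // ler_norml.
have := key false; have := key true; rewrite expr0 expr1 mul1r mulN1r.
by rewrite -/(\sum_z g z) => h1 h2; apply/andP; split; move: h1 h2; rewrite /g; lra.
Qed.

Variables (n m t : nat) (D : distribution R (cube m)) (gamma : R).
Variables (C : cube n -> cube m) (h : 'I_m -> 'I_t -> 'I_n).
Variable F : 'I_m -> {ffun 'I_t -> bool} -> bool.
Hypotheses (CE : forall i x, C x i = F i (restrict (h i) x)).
Hypotheses (bias : biased gamma D) (gamma_ge0 : 0 <= gamma).

Lemma Pr_Range_le (Phi : {ffun 'I_m -> bool} -> R) :
  (forall b, 0 <= Phi b) -> (forall x, 1 <= Phi (C x)) ->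
  Pr D (fun b => b \in Range C) <= expect D Phi.
Proof.
move=> P0 P1; rewrite PrE; apply: le_expect => b.
by case: imsetP => [[x _ ->]|_]; [exact: P1|exact: P0].
Qed.

(** Pigeonhole: [X] has more than [2 ^ n] subsets, so two of them have the same linear part in [x].
    The xor [Y] of their indicators is a nonzero frequency whose character is constant on the
    range. *)
Lemma Pr_Range_xor (X : {set 'I_m}) : (n < #|X|)%N -> (forall i, i \in X -> is_xor (F i)) ->
  Pr D (fun b => b \in Range C) <= 2^-1 * (1 + gamma).
Proof.
move=> nX Xxor.
have /fin_all_exists[s sE] : forall i, exists s : bool, i \in X ->
    forall z, (-1) ^+ F i z = (-1) ^+ s * char (onesv t) z :> R.
  move=> i; have [iX|] := boolP (i \in X); last by exists false.
  by have /existsP[s /forallP hs] := Xxor i iX; exists s => _ z; apply/eqP.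
pose row i : {ffun 'I_n -> bool} := \sum_k unitv (h i k).
have rowE i x : char (onesv t) (restrict (h i) x) = char (row i) x :> R.
  rewrite /row char_sum; apply: eq_bigr => k _.
  by rewrite char_unitv /restrict !ffunE.
pose rows (I : {set 'I_m}) : {ffun 'I_n -> bool} := \sum_(i in I) row i.
pose ind (I : {set 'I_m}) : {ffun 'I_m -> bool} := \sum_(i in I) unitv i.
have indE (I : {set 'I_m}) (x : {ffun 'I_n -> bool}) : I \subset X ->
    char (ind I) (C x) = (\prod_(i in I) (-1) ^+ s i) * char (rows I) x :> R.
  move=> /subsetP IX; rewrite /ind /rows !char_sum -big_split; apply: eq_bigr => i iI /=.
  by rewrite char_unitv CE sE ?rowE // IX.
have ind_in (I : {set 'I_m}) j : ind I j = (j \in I).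
  rewrite /ind; have [jI|jI] := boolP (j \in I).
    rewrite (bigD1 j) //= xorvE ffunE eqxx.
    rewrite (_ : (\sum_(i in I | i != j) unitv i) j = false) //.
    apply: (big_ind (fun v : {ffun 'I_m -> bool} => v j = false)) => [|v v' hv hv'|i /andP[_ ij]].
    - by rewrite ffunE.
    - by rewrite xorvE hv hv'.
    - by rewrite ffunE eq_sym (negbTE ij).
  apply: (big_ind (fun v : {ffun 'I_m -> bool} => v j = false)) => [|v v' hv hv'|i iI].
  - by rewrite ffunE.
  - by rewrite xorvE hv hv'.
  - by rewrite ffunE; apply: contraNF jI => /eqP ->.
have : ~~ dinjectiveb rows (mem (powerset X)).
  apply/negP => /dinjectiveP inj; have := max_card (mem (rows @: powerset X)).
  by rewrite card_in_imset // card_powerset card_ffun card_bool card_ord leq_exp2l // leqNgt nX.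
case/dinjectivePn => I1 I1X [I2 /andP[/= I21 I2X] rE].
rewrite /= !powersetE in I1X I2X.
pose Y := ind I1 + ind I2.
have Y0 : Y != 0.
  rewrite xorv_eq0; apply: contra I21 => /eqP e; apply/eqP/setP => j.
  by rewrite -!ind_in e.
have [a aE] : exists a : bool, forall x, char Y (C x) = (-1) ^+ a :> R.
  exists (\sum_(i in I1) s i + \sum_(i in I2) s i) => x.
  have prodE (I : {set 'I_m}) : \prod_(i in I) (-1) ^+ s i = (-1) ^+ (\sum_(i in I) s i)%R :> R.
    apply: (big_ind2 (fun (x : R) (y : bool) => x = (-1) ^+ y)) => [//|y z y' z' -> ->|//].
    by rewrite signr_addb.
  rewrite /Y charD !indE // rE mulrACA char_sqr mulr1 !prodE.
  by rewrite -signr_addb.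
(* This test is the indicator that the character of [Y] takes its constant value [(-1) ^+ a]. *)
apply: (@le_trans _ _ (expect D (fun b => 2^-1 * (1 + (-1) ^+ a * char Y b)))).
  apply: Pr_Range_le => [b|x]; last by rewrite aE -expr2 sqrr_sign; lra.
  by have [c ->] := @char_sign R m Y b; case: a {aE}; case: c; rewrite /= ?expr0 ?expr1; lra.
rewrite expectZ ler_pM2l // ?invr_gt0 //.
have -> : expect D (fun b => 1 + (-1) ^+ a * char Y b) = 1 + (-1) ^+ a * expect D (char Y).
  rewrite -[X in _ = X + _](expect1 D) -expectZ -big_split; apply: eq_bigr => b _.
  by rewrite /= mulrDr.
rewrite lerD2l; apply: le_trans (ler_norm _) _; rewrite normrM normr_sign mul1r.
exact: biased_expect.
Qed.

Variables (J : {set 'I_m}) (e r p k : nat) (delta tau theta : R).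
Hypothesis nonxor : forall i, i \in J -> ~~ is_xor (F i).
Hypothesis tE : t = (e + (r + r)).+1.

Let M : R := #|J|%:R.
Let N : R := n.+1%:R ^+ r.
Let P : R := n.+1%:R ^+ e.

Hypotheses (M_gt0 : 0 < M) (delta_gt0 : 0 < delta) (delta_le : 3 * delta * 2 ^+ t <= 2 * 2 ^- t).
Hypotheses (tau_gt0 : 0 < tau) (tau_large : 4 <= tau * delta ^+ 2).
Hypotheses (theta_gt0 : 0 < theta) (theta_le1 : theta <= 1) (pE : p = (2 ^ k)%N).
Hypotheses (P_le : P <= delta ^+ 2 * M / 4) (N_le : (16 * p)%:R * N <= theta ^+ 4 * M).
Hypothesis PN_le : (16 * p)%:R * tau * P * N ^+ 2 <= theta ^+ 4 * M ^+ 2.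

(** On the range the terms [T Z] sum to [M], and the full frequency supplies at most
    [(1 - 2 * 2 ^- t) * M]. The deficit forces some other frequency to reach [3 * delta * M];
    summing the tests over all frequencies costs the factor [2 ^+ t]. *)
Lemma Pr_Range_nonxor :
  Pr D (fun b => b \in Range C) <=
  2 ^+ t * (3 * (2 * (delta ^+ 2 / 8) ^- (2 * p) *
    (gamma + N ^+ 2 * (2 * theta ^+ 2) ^+ (2 * p)))).
Proof.
set B := 3 * _.
have B0 : 0 <= B.
  have e0 : 0 <= (delta ^+ 2 / 8) ^- (2 * p).
    by rewrite invr_ge0 exprn_ge0 // divr_ge0 // exprn_ge0 // ltW.
  have e1 : 0 <= (2 * theta ^+ 2) ^+ (2 * p).
    by rewrite exprn_ge0 // mulr_ge0 // exprn_ge0 // ltW.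
  by rewrite /B !mulr_ge0 // addr_ge0 // mulr_ge0 // sqr_ge0.
pose wt Z i : R := fourier (fun z => (-1) ^+ F i z) Z.
pose T Z (b : {ffun 'I_m -> bool}) x : R :=
  \sum_(i in J) wt Z i * (-1) ^+ b i * char Z (restrict (h i) x).
have /fin_all_exists[Phi PhiP] : forall Z, exists Phi : {ffun 'I_m -> bool} -> R,
    [/\ forall b, 0 <= Phi b, expect D Phi <= B &
     Z != onesv t -> forall b x, 3 * delta * M <= `|T Z b x| -> 1 <= Phi b].
  move=> Z; have [->|Z1] := eqVneq Z (onesv t).
    exists (fun=> 0); split=> //.
    by rewrite /expect big1 // => b _; rewrite mulr0.
  have Zc : (#|[set k | Z k]| <= e + (r + r))%N.
    rewrite -ltnS -tE -[X in (_ < X)%N](card_ord t) -cardsT proper_card // properT.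
    apply: contra Z1 => /eqP/setP Zf; apply/eqP/ffunP => i.
    by have := Zf i; rewrite !inE ffunE.
  have [u [a [b ZE]]] := @char_split R t e r Z Zc.
  have cU : #|{ffun 'I_e -> option 'I_n}|%:R = P by rewrite card_ffun card_option !card_ord natrX.
  have cV : #|{ffun 'I_r -> option 'I_n}|%:R = N by rewrite card_ffun card_option !card_ord natrX.
  have U0 : (0 < #|{ffun 'I_e -> option 'I_n}|)%N.
    by rewrite -(ltr0n R) cU exprn_gt0 // ltr0n.
  have V0 : (0 < #|{ffun 'I_r -> option 'I_n}|)%N.
    by rewrite -(ltr0n R) cV exprn_gt0 // ltr0n.
  have [Phi [P0 PE P1]] := @xor_test R m J (wt Z) delta tau theta gamma p k D
    (fun i => fourier_le1 (F i) Z) M_gt0 delta_gt0 tau_gt0 tau_large theta_gt0 theta_le1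
    bias gamma_ge0 pE _ _ (fun i => u n (h i)) (fun i => a n (h i)) (fun i => b n (h i))
    U0 V0 (etrans (congr1 (fun z => z <= _) cU) P_le)
    (etrans (congr1 (fun z => _ * z <= _) cV) N_le)
    (etrans (congr2 (fun y z => _ * y * z ^+ 2 <= _) cU cV) PN_le).
  exists Phi; split=> //; first by rewrite /B -cV.
  move=> _ y x hT; apply: (P1 y (fsign x) (fsign x)) => [g|v|]; rewrite ?fsign_sqr //.
  by apply: le_trans hT _; rewrite le_eqVlt; apply/orP; left; apply/eqP; congr (`|_|);
    apply: eq_bigr => i _; rewrite ZE.
apply: (@le_trans _ _ (expect D (fun b => \sum_Z Phi Z b))).
  apply: Pr_Range_le => [b|x].
    by apply: sumr_ge0 => Z _; have [] := PhiP Z.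
  (* Fourier inversion at [b = C x] gives each output the product of a sign with itself. *)
  have sumT : \sum_Z T Z (C x) x = M.
    rewrite /T exchange_big /= /M -sum1_card natr_sum; apply: eq_bigr => i iJ.
    rewrite (_ : \sum_Z _ = (-1) ^+ C x i * \sum_Z wt Z i * char Z (restrict (h i) x)).
      by rewrite -fourier_inversion CE -expr2 sqrr_sign.
    by rewrite mulr_sumr; apply: eq_bigr => Z _; ring.
  have T1 : `|T (onesv t) (C x) x| <= (1 - 2 * 2 ^- t) * M.
    apply: le_trans (ler_norm_sum _ _ _) _; rewrite /M mulr_natr -sumr_const.
    apply: ler_sum => i iJ; rewrite normrM normrM normr_sign norm_char !mulr1.
    exact: (fourier_ones (nonxor iJ)).
  have [Z [Z1 hZ]] : exists Z, Z != onesv t /\ 3 * delta * M <= `|T Z (C x) x|.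
    have [/existsP[Z /andP[]]|] := boolP [exists Z, (Z != onesv t) &&
        (3 * delta * M <= `|T Z (C x) x|)]; first by exists Z.
    rewrite negb_exists => /forallP small; exfalso.
    have dM : 0 < 3 * delta * M by rewrite !mulr_gt0.
    have le : \sum_(Z | Z != onesv t) T Z (C x) x <= (2 ^+ t - 1) * (3 * delta * M).
      apply: (@le_trans _ _ (\sum_(Z : {ffun 'I_t -> bool} | Z != onesv t) (3 * delta * M))).
        apply: ler_sum => Z Z1; apply: le_trans (ler_norm _) _; apply: ltW.
        by have := small Z; rewrite Z1 /= -ltNge.
      have tot : \sum_(Z : {ffun 'I_t -> bool}) (3 * delta * M) = 2 ^+ t * (3 * delta * M).
        by rewrite sumr_const card_ffun card_bool card_ord -[LHS]mulr_natl natrX.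
      rewrite (bigD1 (onesv t)) //= in tot.
      by rewrite mulrBl mul1r; move: tot; lra.
    have := sumT; rewrite (bigD1 (onesv t)) //= => sT.
    have T1' := le_trans (ler_norm _) T1.
    have dl : 3 * delta * 2 ^+ t * M <= 2 * 2 ^- t * M by rewrite ler_pM2r.
    have : (2 ^+ t - 1) * (3 * delta * M) = 3 * delta * 2 ^+ t * M - 3 * delta * M by ring.
    by move: T1' le sT dl dM; lra.
  rewrite (bigD1 Z) //=; have [_ _ P1] := PhiP Z; apply: ler_wpDr; last exact: P1 hZ.
  by apply: sumr_ge0 => Z' _; have [] := PhiP Z'.
rewrite expect_sum; apply: (@le_trans _ _ (\sum_(Z : {ffun 'I_t -> bool}) B)).
  by apply: ler_sum => Z _; have [] := PhiP Z.
by rewrite sumr_const card_ffun card_bool card_ord -[leLHS]mulr_natl natrX.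
Qed.

End Local.

(** * Choice of parameters *)

(** The walk length must be a power of two comparable to the logarithm of [n]. The largest [k]
    satisfying the lower bound works; the [- 1] makes [k = 0] admissible for every positive [n]. *)
Lemma dyadic_scale (n : nat) : (0 < n)%N ->
  exists k, (2 ^ (12 * (2 ^ k - 1)) <= n < 2 ^ (24 * 2 ^ k))%N.
Proof.
move=> n0; pose Q k := (2 ^ (12 * (2 ^ k - 1)) <= n)%N.
have Q0 : exists k, Q k by exists 0%N; rewrite /Q expn0.
have Qn k : Q k -> (k <= n.+1)%N.
  rewrite /Q => h.
  have h1 : (k < 2 ^ k)%N by rewrite ltn_expl.
  have h2 : (12 * (2 ^ k - 1) < 2 ^ (12 * (2 ^ k - 1)))%N by rewrite ltn_expl.
  by lia.
case: (ex_maxnP Q0 Qn) => k Qk kmax; exists k; rewrite [X in X && _]Qk ltnNge /=.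
apply/negP => h; have : Q k.+1.
  by rewrite /Q; apply: leq_trans h; rewrite leq_exp2l // expnS; lia.
by move/kmax; rewrite ltnn.
Qed.

Section Numerics.
Context {R : realFieldType}.

Lemma ratio_le (a b : nat) : (a + 5 <= b)%N -> 18 * 2 ^+ a <= 2 ^+ b :> R.
Proof.
move=> ab; apply: (@le_trans _ _ (2 ^+ (a + 5))); last first.
  by apply: ler_weXn2l => //; lra.
rewrite exprD mulrC ler_wpM2l ?exprn_ge0 //.
by rewrite (_ : 2 ^+ 5 = 32 :> R) ?ler_nat // -natrX.
Qed.

(** All quantities become powers of 2. After multiplication by [2 ^+ t] and the power of [delta],
    the bias term and the cancelling-walk term are each at most 1/18, and
    [6 * (1/18 + 1/18) = 2/3]. *)
Lemma final_bound (t p : nat) (n N gamma : R) : (3 <= t)%N -> (0 < p)%N ->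
  2 ^+ (12 * (p - 1)) <= n -> n <= 2 ^+ (24 * p) ->
  gamma <= (2 ^+ 15 * n) ^- t -> 0 <= N -> N ^+ 2 <= (2 * n) ^+ t ->
  2 ^+ t * (3 * (2 * ((2 ^- (2 * t + 1)) ^+ 2 / 8) ^- (2 * p) *
    (gamma + N ^+ 2 * (2 * (2 ^- (12 * t)) ^+ 2) ^+ (2 * p)))) <= 2 / 3 :> R.
Proof.
move=> t3 p0 nl nu gl N0 Nl.
have x0 k : 0 < 2 ^+ k :> R by rewrite exprn_gt0.
have -> : ((2 ^- (2 * t + 1)) ^+ 2 / 8) ^- (2 * p) = 2 ^+ ((4 * t + 5) * (2 * p)) :> R.
  have -> : (2 ^- (2 * t + 1)) ^+ 2 / 8 = (2 ^+ (4 * t + 5))^-1 :> R.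
    have -> : 8 = 2 ^+ 3 :> R by rewrite -natrX.
    rewrite exprVn -exprM.
    by rewrite -invfM -exprD; congr (_ ^+ _)^-1; lia.
  by rewrite exprVn invrK -exprM.
have -> : (2 * (2 ^- (12 * t)) ^+ 2) ^+ (2 * p) = 2 ^- ((24 * t - 1) * (2 * p)) :> R.
  have -> : 2 * (2 ^- (12 * t)) ^+ 2 = (2 ^+ (24 * t - 1))^-1 :> R.
    rewrite exprVn -exprM (_ : (12 * t * 2 = (24 * t - 1).+1)%N); last by lia.
    by rewrite exprS invfM mulrA mulfV ?mul1r // pnatr_eq0.
  by rewrite exprVn -exprM.
have {}gl : gamma <= 2 ^- ((12 * p + 3) * t).
  apply: le_trans gl _; rewrite lef_pV2 ?posrE //; last first.
    by rewrite exprn_gt0 // mulr_gt0 // (lt_le_trans _ nl).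
  rewrite exprM lerXn2r ?nnegrE ?exprn_ge0 ?mulr_ge0 //.
    by apply: le_trans nl; rewrite ltW.
  rewrite (_ : (12 * p + 3 = 15 + 12 * (p - 1))%N); last by lia.
  by rewrite exprD ler_pM2l.
have {}Nl : N ^+ 2 <= 2 ^+ ((24 * p + 1) * t).
  apply: le_trans Nl _; rewrite exprM lerXn2r ?nnegrE ?exprn_ge0 ?mulr_ge0 //.
    by apply: le_trans nl; rewrite ltW.
  by rewrite addn1 exprS ler_pM2l.
set E := 2 ^+ ((4 * t + 5) * (2 * p)).
have E0 : 0 < E by exact: x0.
have h1 : 2 ^+ t * E * gamma <= 18^-1.
  apply: (@le_trans _ _ (2 ^+ t * E * 2 ^- ((12 * p + 3) * t))).
    by rewrite ler_pM2l // mulr_gt0.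
  rewrite ler_pdivrMr // -ler_pdivrMl ?invr_gt0 // invrK /E -exprD.
  by apply: ratio_le; nia.
have h2 : 2 ^+ t * E * (N ^+ 2 * 2 ^- ((24 * t - 1) * (2 * p))) <= 18^-1.
  apply: (@le_trans _ _ (2 ^+ t * E * (2 ^+ ((24 * p + 1) * t) / 2 ^+ ((24 * t - 1) * (2 * p))))).
    by rewrite ler_pM2l ?mulr_gt0 // ler_pM2r ?invr_gt0.
  rewrite mulrA ler_pdivrMr // -ler_pdivrMl ?invr_gt0 // invrK /E -!exprD.
  by apply: ratio_le; nia.
set z := N ^+ 2 * _ in h2 *.
rewrite (_ : 2 ^+ t * _ = 6 * (2 ^+ t * E * gamma + 2 ^+ t * E * z)); last by ring.
by lra.
Qed.

End Numerics.

(* [B] plays the role of [n ^ ((t - 1) / 2)] and [l] that of [log2 n]. *)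
Lemma size_conditions (R : realFieldType) (t n e r p : nat) (M B l : R) :
  t = (e + (r + r)).+1 -> (e <= 1)%N -> (3 <= t)%N -> (2 <= n)%N ->
  1 <= l -> n%:R <= B -> B ^+ 2 = n%:R ^+ (t - 1) -> p%:R <= 2 * l ->
  2 ^+ (59 * t) * B * l <= M ->
  [/\ n.+1%:R ^+ e <= (2 ^- (2 * t + 1)) ^+ 2 * M / 4,
      (16 * p)%:R * n.+1%:R ^+ r <= (2 ^- (12 * t)) ^+ 4 * M &
      (16 * p)%:R * 2 ^+ (4 * t + 4) * n.+1%:R ^+ e * (n.+1%:R ^+ r) ^+ 2 <=
        (2 ^- (12 * t)) ^+ 4 * M ^+ 2].
Proof.
move=> tE e1 t3 n2 l1 nB B2 pl ML.
have x0 k : 0 < 2 ^+ k :> R by rewrite exprn_gt0.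
have n1 : 1 <= n.+1%:R :> R by rewrite ler1n.
have n0 : 2 <= n%:R :> R by rewrite ler_nat.
have B0 : 0 < B by apply: lt_le_trans nB; lra.
have M0 : 0 < M by apply: lt_le_trans ML; rewrite !mulr_gt0 //; lra.
have Sn : n.+1%:R <= 2 * n%:R :> R by rewrite -natrM ler_nat; clear -n2; lia.
have le2 a b : (a <= b)%N -> 2 ^+ a <= 2 ^+ b :> R.
  by move=> ab; apply: ler_weXn2l => //; lra.
have Ml k : (k <= 59 * t)%N -> 2 ^+ k * B * l <= M.
  move=> hk; apply: le_trans ML; rewrite ler_pM2r; last by lra.
  by rewrite ler_pM2r // le2.
(* The exponents add up to [t - 1], so passing from [n.+1] to [2 * n] costs less than the allowed
   [2 ^+ t] squared. *)
have NB : n.+1%:R ^+ e * (n.+1%:R ^+ r) ^+ 2 <= (2 ^+ t * B) ^+ 2 :> R.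
  rewrite -exprM -exprD (_ : (e + r * 2 = t - 1)%N); last by clear -t3 tE e1; lia.
  apply: (@le_trans _ _ ((2 * n%:R) ^+ (t - 1))).
    by rewrite lerXn2r ?nnegrE // mulr_ge0 //; lra.
  rewrite !exprMn B2 ler_pM2r ?exprn_gt0 //; last by lra.
  by rewrite -exprM le2 //; clear; lia.
have p16 : (16 * p)%:R <= 2 ^+ 5 * l.
  have -> : 2 ^+ 5 = 32 :> R by rewrite -natrX.
  by rewrite natrM; lra.
have th4 : (2 ^- (12 * t)) ^+ 4 = 2 ^- (48 * t) :> R.
  by rewrite exprVn -exprM; congr (_ ^+ _)^-1; clear; lia.
rewrite th4; split.
- have -> : (2 ^- (2 * t + 1)) ^+ 2 * M / 4 = 2 ^- (4 * t + 4) * M.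
    have -> : 4 = 2 ^+ 2 :> R by rewrite -natrX.
    rewrite exprVn -exprM mulrAC -invfM -exprD; congr (_ ^- _ * _); clear; lia.
  rewrite ler_pdivlMl //; apply: (@le_trans _ _ (2 ^+ (4 * t + 4) * (2 * n%:R))).
    rewrite ler_pM2l //; apply: le_trans Sn.
    by rewrite -[leRHS]expr1; apply: ler_weXn2l.
  apply: le_trans (Ml (4 * t + 5)%N _); last by clear -t3 tE e1; lia.
  rewrite (_ : (4 * t + 5 = (4 * t + 4).+1)%N); last by clear -t3 tE e1; lia.
  rewrite exprSr -!mulrA ler_pM2l // ler_pM2l //.
  by apply: le_trans nB _; rewrite ler_peMr // ltW.
- rewrite ler_pdivlMl //.
  have rB : n.+1%:R ^+ r <= 2 ^+ t * B.
    have tB : 0 <= 2 ^+ t * B by rewrite mulr_ge0 // ltW.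
    rewrite -(@ler_sqr R) ?nnegrE ?exprn_ge0 //.
    apply: le_trans NB; rewrite ler_peMl ?sqr_ge0 //.
    by apply: exprn_ege1.
  apply: (@le_trans _ _ (2 ^+ (48 * t) * (2 ^+ 5 * l * (2 ^+ t * B)))).
    by rewrite ler_pM2l // ler_pM // exprn_ge0.
  apply: le_trans (Ml (48 * t + 5 + t)%N _); last by clear -t3 tE e1; lia.
  by rewrite le_eqVlt; apply/orP; left; apply/eqP; rewrite !exprD; ring.
- rewrite ler_pdivlMl // -[X in _ * X <= _]mulrA.
  apply: (@le_trans _ _ (2 ^+ (48 * t) * (2 ^+ 5 * l * 2 ^+ (4 * t + 4) * (2 ^+ t * B) ^+ 2))).
    rewrite ler_pM2l // ler_pM ?mulr_ge0 ?exprn_ge0 //.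
    by rewrite ler_pM2r.
  have h := Ml (59 * t)%N (leqnn _).
  apply: (@le_trans _ _ ((2 ^+ (59 * t) * B * l) ^+ 2)); last first.
    rewrite lerXn2r ?nnegrE //; last exact: ltW.
    by rewrite !mulr_ge0 // ?ltW //; lra.
  have -> : 2 ^+ (48 * t) * (2 ^+ 5 * l * 2 ^+ (4 * t + 4) * (2 ^+ t * B) ^+ 2) =
      2 ^+ (48 * t + 5 + (4 * t + 4) + t + t) * (B ^+ 2 * l) by rewrite !exprD; ring.
  have -> : (2 ^+ (59 * t) * B * l) ^+ 2 = 2 ^+ (59 * t * 2) * (B ^+ 2 * (l * l)).
    by rewrite !exprMn -exprM; ring.
  have l0 : 0 <= l by lra.
  apply: ler_pM.
  + exact: ltW.
  + by rewrite mulr_ge0 ?sqr_ge0.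
  + by rewrite le2 //; clear -t3; lia.
  + by rewrite ler_wpM2l ?sqr_ge0 // ler_peMr.
Qed.

Lemma powR_half (R : realType) (n t : nat) : (3 <= t)%N -> (1 <= n)%N ->
  let B : R := n%:R `^ ((t%:R - 1) / 2) in
  n%:R <= B /\ B ^+ 2 = n%:R ^+ (t - 1).
Proof.
move=> t3 n1 B; have t3R : 3 <= t%:R :> R by rewrite ler_nat.
have n1R : 1 <= n%:R :> R by rewrite ler1n.
split.
  by rewrite -[leLHS]powRr1 ?ler0n // /B ler_powR //; lra.
rewrite /B -powR_mulrn ?powR_ge0 // -powRrM -powR_mulrn ?ler0n //.
by rewrite natrB ?(leq_trans _ t3) //; congr (_ `^ _); lra.
Qed.

(** The case [n = 1] is excluded because [log2 1 = 0] voids the size condition: for [m = 1] the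
    identity map has full range. *)
Theorem theorem5p1 (R : realType) :
  exists c_bias c_nonadaptive : R,
    [/\ 0 < c_bias, 0 < c_nonadaptive &
      forall (t n m : nat), (3 <= t)%N -> (2 <= n)%N -> (1 <= m)%N ->
      forall D : distribution R (cube m),
        biased ((c_bias * n%:R) ^- t) D ->
      forall C : cube n -> cube m,
        (forall i : 'I_m, depends_on_at_most t (fun x => C x i)) ->
        c_nonadaptive ^+ t * n%:R `^ ((t%:R - 1) / 2) * log2 n%:R <= m%:R ->
        Pr D (fun b => b \in Range C) <= 2 / 3].
Proof.
exists (2 ^+ 15), (2 ^+ 60); split; [by rewrite exprn_gt0|by rewrite exprn_gt0|].
move=> t n m t3 n2 m1 D bias C dep mlarge.
have x0 k : 0 < 2 ^+ k :> R by rewrite exprn_gt0.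
have n0 : (0 < n)%N by apply: leq_trans n2.
have n0R : 0 < n%:R :> R by rewrite ltr0n.
have n2R : 2 <= n%:R :> R by rewrite ler_nat.
set gamma := _ ^- t in bias.
have gamma0 : 0 <= gamma by rewrite invr_ge0 exprn_ge0 // mulr_ge0 // ltW.
have /fin_all_exists[hF CE] := fun i => local_repr n0 (dep i).
pose h i := (hF i).1; pose F i := (hF i).2.
have {}CE i x : C x i = F i (restrict (h i) x) := CE i x.
have [nB B2] := @powR_half R n t t3 n0.
set B := n%:R `^ _ in nB B2 mlarge; set l := log2 _ in mlarge.
have ln2 : 0 < ln 2 :> R by rewrite ln_gt0 // ltr1n.
have l1 : 1 <= l by rewrite /l /log2 ler_pdivlMr // mul1r ler_ln // posrE.
have l0 : 0 < l by apply: lt_le_trans l1.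
have B0 : 0 < B by apply: lt_le_trans nB.
have [k /andP[kl ku]] := dyadic_scale n0.
pose p := (2 ^ k)%N; rewrite -/p in kl ku.
have p0 : (0 < p)%N by rewrite expn_gt0.
have pl : p%:R <= 2 * l.
  have : (12 * (p - 1))%:R <= l.
    rewrite /l /log2 ler_pdivlMr // mulr_natl -lnXn // -natrX.
    by rewrite ler_ln ?posrE ?ltr0n ?expn_gt0 // ler_nat.
  by rewrite natrM natrB //; lra.
(* Up to [n] outputs may be discarded; lowering the exponent from [60 * t] to [59 * t] pays for
   them, since [n] is at most [B * l]. *)
have X2 : 2 ^+ (59 * t) * B * l <= m%:R - n%:R.
  have Bl : 0 < B * l by rewrite mulr_gt0.
  have nBl : n%:R <= B * l by apply: le_trans nB _; rewrite ler_peMr // ltW.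
  rewrite lerBrDr; apply: le_trans mlarge; rewrite -!mulrA -exprM.
  apply: (@le_trans _ _ ((2 ^+ (59 * t) + 1) * (B * l))).
    by rewrite mulrDl mul1r lerD2l.
  rewrite ler_pM2r //; apply: (@le_trans _ _ (2 ^+ (59 * t).+1)).
    by rewrite exprS mulr_natl mulr2n lerD2l exprn_ege1 //; lra.
  by apply: ler_weXn2l; [lra|clear -t3; lia].
(* Either more than [n] outputs are signed full parities, or [J] keeps at least [m - n] outputs. *)
pose X := [set i | is_xor (R := R) (F i)].
have [nX|Xn] := ltnP n #|X|.
  have : Pr D (fun b => b \in Range C) <= 2^-1 * (1 + gamma).
    by apply: (Pr_Range_xor CE bias nX) => i; rewrite inE.
  suff : gamma <= 3^-1 by lra.
  rewrite /gamma lef_pV2 ?posrE ?exprn_gt0 ?mulr_gt0 //.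
  have c1 : 3 <= 2 ^+ 15 * n%:R :> R.
    have : 2 <= 2 ^+ 15 :> R by rewrite exprS ler_peMr // exprn_ege1 //; lra.
    by move=> h2; apply: (@le_trans _ _ (2 * 2)); [lra|apply: ler_pM].
  apply: le_trans c1 _; rewrite -[leLHS]expr1; apply: ler_weXn2l; last by clear -t3; lia.
  lra.
pose J := ~: X.
have JM : 2 ^+ (59 * t) * B * l <= #|J|%:R.
  apply: le_trans X2 _; rewrite lerBlDr -natrD ler_nat.
  by rewrite -[X in (X <= _)%N](card_ord m) -(cardsC X) addnC leq_add2l.
pose r := ((t - 1) %/ 2)%N; pose e := ((t - 1) %% 2)%N.
have tE : t = (e + (r + r)).+1 by rewrite /e /r; clear -t3; lia.
have e1 : (e <= 1)%N by rewrite /e; clear -t3; lia.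
have [P_le N_le PN_le] := size_conditions tE e1 t3 n2 l1 nB B2 pl JM.
have J0 : 0 < #|J|%:R :> R.
  by apply: lt_le_trans JM; rewrite mulr_gt0 // mulr_gt0.
have nonxor i : i \in J -> ~~ is_xor (R := R) (F i) by rewrite !inE.
have d0 : 0 < 2 ^- (2 * t + 1) :> R by rewrite invr_gt0.
(* With [delta = 2 ^- (2 * t + 1)] the left side is [3 / 2 * 2 ^- t]. *)
have dle : 3 * 2 ^- (2 * t + 1) * 2 ^+ t <= 2 * 2 ^- t :> R.
  rewrite (_ : (2 * t + 1 = t + t.+1)%N); last by clear; lia.
  rewrite exprD exprS !invfM.
  have -> : 3 * (2 ^- t * (2^-1 * 2 ^- t)) * 2 ^+ t = 3 / 2 * 2 ^- t :> R.
    by field; rewrite gt_eqF.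
  by rewrite ler_pM2r ?invr_gt0 //; lra.
(* The threshold [tau = 2 ^+ (4 * t + 4)] is exactly 4 divided by the square of [delta]. *)
have tau1 : 4 <= 2 ^+ (4 * t + 4) * (2 ^- (2 * t + 1)) ^+ 2 :> R.
  rewrite exprVn -exprM ler_pdivlMr //.
  have -> : 4 = 2 ^+ 2 :> R by rewrite -natrX.
  by rewrite -exprD; apply: ler_weXn2l; [lra|clear; lia].
have th0 : 0 < 2 ^- (12 * t) :> R by rewrite invr_gt0.
have th1 : 2 ^- (12 * t) <= 1 :> R by rewrite invf_le1 // exprn_ege1 //; lra.
apply: le_trans (Pr_Range_nonxor CE bias gamma0 nonxor tE J0 d0 dle (x0 _) tau1 th0 th1
  (erefl p) P_le N_le PN_le) _.
apply: (final_bound (n := n%:R)) => //.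
- by rewrite -natrX ler_nat.
- by rewrite -natrX ler_nat ltnW.
- by rewrite exprn_ge0.
- rewrite -exprM; apply: (@le_trans _ _ ((2 * n%:R) ^+ (r * 2))).
    by rewrite lerXn2r ?nnegrE ?mulr_ge0 ?(ltW n0R) // -natrM ler_nat; clear -n2; lia.
  by apply: ler_weXn2l; [lra|rewrite /r; clear -t3; lia].
Qed.
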